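(* Let $n=2$, let $G\leq\mathrm{GL}(V)=\mathrm{GL}_2(\mathbb{K})$ be a finite group, let $q\in\mathbb{K}^*$, and consider quantum Drinfeld Hecke algebras $\mathcal{H}_{Q,\kappa}$ for $G$ with $q_{12}=q$. (1) If $q=1$, the set of quantum Drinfeld Hecke algebras comprises all quotients of the form $\mathbb{K}\langle v_1,v_2\rangle\#G/\langle v_2v_1-v_1v_2-\sum_{g\in G,\ \det(g)=1}c_gt_g\rangle$, where the scalars $c_g\in\mathbb{K}$ are arbitrary for $g$ in a set of determinant-one conjugacy class representatives of $G$, subject to $c_{h^{-1}gh}=\det(h)\,c_g$ for all $h\in G$. Here the coefficient $c_g$ is zero or the centralizer $Z_G(g)$ is a subgroup of $\mathrm{SL}_2(\mathbb{K})$; in particular, the coefficient of the identity group element is zero unless $G\leq\mathrm{SL}_2(\mathbb{K})$. (2) If $q\ne\pm1$ (including the case of $q$ transcendental over a subfield), quantum Drinfeld Hecke algebras all arise from an abelian group $G$ acting diagonally on $v_1,v_2$. If $\det_Q(g)=1$ for all $g\in G$, then the set of quantum Drinfeld Hecke algebras comprises all quotients of the form $\mathbb{K}\langle v_1,v_2\rangle\#G/\langle v_2v_1-q\,v_1v_2-\sum_{g\in G}c_gt_g\rangle$ where the scalars $c_g\in\mathbb{K}$ are arbitrary. If some element of $G$ has $\det_Q\ne1$, then $\kappa$ is identically zero and $\mathcal{H}_{Q,\kappa}$ is just $S_Q(V)\#G$. (3) If $q=-1$, the set of quantum Drinfeld Hecke algebras comprises all quotients of the form $\mathbb{K}\langle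 v_1,v_2\rangle\#G/\langle v_2v_1+v_1v_2-\sum_{g\in G}c_gt_g\rangle$, where the scalars $c_g\in\mathbb{K}$ are arbitrary for $g$ in a set of conjugacy class representatives of a monomial group $G\leq\mathrm{GL}_2(\mathbb{K})$, subject to $c_{h^{-1}gh}=\det_Q(h)\,c_g$ for all $h\in G$. In particular, $c_g=0$ if some element $h$ of the centralizer $Z_G(g)$ has $\det_Q(h)\ne1$.
   Context: Let $\mathbb{K}$ be a field (of arbitrary characteristic), $V$ a $2$-dimensional $\mathbb{K}$-vector space with fixed basis $v_1,v_2$, and $G\subset \mathrm{GL}(V)$ a finite group. $\{t_g: g\in G\}$ is the standard basis of $\mathbb{K}G$, with $t_e$ identified with $1$. Given nonzero scalars $Q=(q_{ij}: 1\le i,j\le 2)$ and elements $\kappa(v_i,v_j)\in\mathbb{K}G$, the algebra $\mathcal{H}_{Q,\kappa}$ is the associative $\mathbb{K}$-algebra generated by $\{v_1,v_2\}\cup\{t_g: g\in G\}$ subject to: (a) $t_gt_h=t_{gh}$ for $g,h\in G$; (b) $t_g v=g(v)t_g$ for $g\in G$, $v\in V$; (c) $v_jv_i=q_{ij}v_iv_j+\kappa(v_i,v_j)$ for $1\le i,j\le 2$. It is a quantum Drinfeld Hecke algebra if $\{v_1^{\alpha_1}v_2^{\alpha_2}t_g: \alpha_i\in\mathbb{N}, g\in G\}$ (with $0\in\mathbb{N}$) is a $\mathbb{K}$-basis of it (this forces $q_{11}=q_{22}=1$ and $q_{21}=q_{12}^{-1}$). $S_Q(V)=\mathbb{K}\langle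 v_1,v_2\rangle/\langle v_2v_1-qv_1v_2\rangle$ where $q=q_{12}$. The quantum determinant is $\det_Q\begin{pmatrix}a&b\\c&d\end{pmatrix}=ad-q\,bc$. $A\#G$ denotes the skew group algebra $A\otimes\mathbb{K}G$ with product $(at_g)(bt_h)=a\,g(b)\,t_{gh}$; $G$ acts on the free algebra $\mathbb{K}\langle v_1,v_2\rangle$ through its action on $V$. $Z_G(g)$ is the centralizer of $g$ in $G$. A group is monomial if it acts by matrices (in the basis $v_1,v_2$) having exactly one nonzero entry in each row and column.
   Formalization: In (2), ''comprises all quotients'' is stated for G acting diagonally (for other G no such algebra exists); in (3), that G must be monomial is stated only when -1 ≠ 1 (it fails in characteristic 2), the classification being stated for monomial G in any characteristic. *)

(* Defs.v *)
From HB Require Import structures.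
From mathcomp Require Import all_boot all_order all_algebra all_fingroup.
From mathcomp Require Import mxrepresentation generic_quotient.
From mathcomp Require Import boolp.
From mathcomp Require Import finmap.
From mathcomp Require Import monalg.

Set Implicit Arguments.
Unset Strict Implicit.
Unset Printing Implicit Defensive.

Import GRing.Theory.

Local Open Scope ring_scope.
Local Open Scope quotient_scope.

Notation alg_morphism f := (linear f /\ monoid_morphism f).
Notation alg_iso f := (alg_morphism f /\ bijective f).

Definition is_basis (K : pzRingType) (M : lmodType K) (I : eqType)
    (b : I -> M) : Prop :=
  (forall (s : seq I) (c : I -> K), uniq s ->
     \sum_(i <- s) c i *: b i = 0 -> forall i, i \in s -> c i = 0) /\
  (forall x : M, exists (s : seq I) (c : I -> K),
     x = \sum_(i <- s) c i *: b i).

Section Quotient.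
Variables (K : pzRingType) (A : algType K).

Definition two_sided_ideal (I : A -> Prop) : Prop :=
  [/\ I 0, forall x y, I x -> I y -> I (x - y),
      forall a x, I x -> I (a * x) & forall a x, I x -> I (x * a)].

Definition ideal_gen (S : A -> Prop) (x : A) : Prop :=
  forall I, two_sided_ideal I -> (forall y, S y -> I y) -> I x.

Variable S : A -> Prop.
Local Notation J := (ideal_gen S).

Lemma ideal_gen_ideal : two_sided_ideal J.
Proof.
split=> [I [] //|x y Jx Jy I iI SI|a x Jx I iI SI|a x Jx I iI SI].
- by case: (iI) => _ + _ _; apply; [apply: Jx|apply: Jy].
- by case: (iI) => _ _ + _; apply; apply: Jx.
- by case: (iI) => _ _ _; apply; apply: Jx.
Qed.

Lemma ideal_genN x : J x -> J (- x).
Proof. by case: ideal_gen_ideal => J0 JB _ _ Jx; rewrite -sub0r; apply: JB. Qed.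

Lemma ideal_genD x y : J x -> J y -> J (x + y).
Proof.
move=> Jx Jy; rewrite -[y]opprK; case: ideal_gen_ideal => _ JB _ _.
by apply: JB => //; apply: ideal_genN.
Qed.

Definition quot_rel : rel A := fun x y => `[< J (x - y) >].

Lemma quot_relP : equiv_class_of quot_rel.
Proof.
split=> [x|x y|y x z].
- by apply/asboolP; rewrite subrr; case: ideal_gen_ideal.
- by apply/asboolP/asboolP => /ideal_genN; rewrite opprB.
- move=> /asboolP Jxy /asboolP Jyz; apply/asboolP.
  by rewrite -(subrKA y); apply: ideal_genD.
Qed.

Canonical quot_equiv := EquivRelPack quot_relP.
Canonical quot_equiv_direct := defaultEncModRel quot_rel.

(* The quotient of A by the two-sided ideal generated by S. It is not an
   [algType], since it may be the zero ring. *)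
Definition quot_alg := {eq_quot quot_rel}.

HB.instance Definition _ := EqQuotient.on quot_alg.
HB.instance Definition _ := Choice.on quot_alg.

Definition quot_pi (x : A) : quot_alg := \pi_quot_alg x.

Lemma quot_piP x y : quot_pi x = quot_pi y <-> J (x - y).
Proof.
by split=> [/eqquotP/asboolP//|Jxy]; apply/eqquotP/asboolP.
Qed.

Lemma quot_reprK x : quot_pi (repr x) = x. Proof. exact: reprK. Qed.

Lemma quot_repr_pi x : J (repr (quot_pi x) - x).
Proof. by apply/quot_piP; rewrite quot_reprK. Qed.

Lemma quot_ind (P : quot_alg -> Prop) : (forall x, P (quot_pi x)) -> forall x, P x.
Proof. by move=> Ppi x; rewrite -[x]quot_reprK. Qed.

Definition quot_add (x y : quot_alg) := quot_pi (repr x + repr y).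
Definition quot_opp (x : quot_alg) := quot_pi (- repr x).
Definition quot_mul (x y : quot_alg) := quot_pi (repr x * repr y).
Definition quot_scale (a : K) (x : quot_alg) := quot_pi (a *: repr x).

Lemma quot_addE x y : quot_add (quot_pi x) (quot_pi y) = quot_pi (x + y).
Proof.
by apply/quot_piP; rewrite opprD addrACA; apply: ideal_genD; apply: quot_repr_pi.
Qed.

Lemma quot_oppE x : quot_opp (quot_pi x) = quot_pi (- x).
Proof. by apply/quot_piP; rewrite -opprD; apply: ideal_genN; apply: quot_repr_pi. Qed.

Lemma quot_mulE x y : quot_mul (quot_pi x) (quot_pi y) = quot_pi (x * y).
Proof.
apply/quot_piP; set x' := repr _; set y' := repr _.
have -> : x' * y' - x * y = x' * (y' - y) + (x' - x) * y.
  by rewrite mulrBr mulrBl addrA subrK.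
case: ideal_gen_ideal => _ _ JMl JMr.
by apply: ideal_genD; [apply: JMl|apply: JMr]; apply: quot_repr_pi.
Qed.

Lemma quot_scaleE a x : quot_scale a (quot_pi x) = quot_pi (a *: x).
Proof.
apply/quot_piP; rewrite -scalerBr -[X in _ *: X]mul1r scalerAl.
by case: ideal_gen_ideal => _ _ JMl _; apply: JMl; apply: quot_repr_pi.
Qed.

Lemma quot_addA : associative quot_add.
Proof.
by elim/quot_ind=> x; elim/quot_ind=> y; elim/quot_ind=> z; rewrite !quot_addE addrA.
Qed.

Lemma quot_addC : commutative quot_add.
Proof. by elim/quot_ind=> x; elim/quot_ind=> y; rewrite !quot_addE addrC. Qed.

Lemma quot_add0 : left_id (quot_pi 0) quot_add.
Proof. by elim/quot_ind=> x; rewrite quot_addE add0r. Qed.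

Lemma quot_addN : left_inverse (quot_pi 0) quot_opp quot_add.
Proof. by elim/quot_ind=> x; rewrite quot_oppE quot_addE addNr. Qed.

HB.instance Definition _ :=
  GRing.isZmodule.Build quot_alg quot_addA quot_addC quot_add0 quot_addN.

Lemma quot_piD x y : quot_pi (x + y) = quot_pi x + quot_pi y.
Proof. by rewrite -quot_addE. Qed.

Lemma quot_mulA : associative quot_mul.
Proof.
by elim/quot_ind=> x; elim/quot_ind=> y; elim/quot_ind=> z; rewrite !quot_mulE mulrA.
Qed.

Lemma quot_mul1 : left_id (quot_pi 1) quot_mul.
Proof. by elim/quot_ind=> x; rewrite quot_mulE mul1r. Qed.

Lemma quot_mulr1 : right_id (quot_pi 1) quot_mul.
Proof. by elim/quot_ind=> x; rewrite quot_mulE mulr1. Qed.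

Lemma quot_mulDl : left_distributive quot_mul +%R.
Proof.
elim/quot_ind=> x; elim/quot_ind=> y; elim/quot_ind=> z.
by rewrite -quot_piD !quot_mulE mulrDl quot_piD.
Qed.

Lemma quot_mulDr : right_distributive quot_mul +%R.
Proof.
elim/quot_ind=> x; elim/quot_ind=> y; elim/quot_ind=> z.
by rewrite -quot_piD !quot_mulE mulrDr quot_piD.
Qed.

HB.instance Definition _ := GRing.Zmodule_isPzRing.Build quot_alg
  quot_mulA quot_mul1 quot_mulr1 quot_mulDl quot_mulDr.

Lemma quot_piM x y : quot_pi (x * y) = quot_pi x * quot_pi y.
Proof. by rewrite -quot_mulE. Qed.

Lemma quot_scaleA a b x : quot_scale a (quot_scale b x) = quot_scale (a * b) x.
Proof. by elim/quot_ind: x => x; rewrite !quot_scaleE scalerA. Qed.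

Lemma quot_scale1 : left_id 1 quot_scale.
Proof. by elim/quot_ind=> x; rewrite quot_scaleE scale1r. Qed.

Lemma quot_scaleDr : right_distributive quot_scale +%R.
Proof.
move=> a; elim/quot_ind=> x; elim/quot_ind=> y.
by rewrite -quot_piD !quot_scaleE scalerDr quot_piD.
Qed.

Lemma quot_scaleDl x : {morph quot_scale^~ x : a b / a + b}.
Proof.
by move=> a b; elim/quot_ind: x => x; rewrite !quot_scaleE scalerDl quot_piD.
Qed.

HB.instance Definition _ := GRing.Zmodule_isLmodule.Build K quot_alg
  quot_scaleA quot_scale1 quot_scaleDr quot_scaleDl.

Lemma quot_piZ a x : quot_pi (a *: x) = a *: quot_pi x.
Proof. by rewrite -quot_scaleE. Qed.

Lemma quot_scalerAl (a : K) (x y : quot_alg) : a *: (x * y) = (a *: x) * y.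
Proof.
elim/quot_ind: x => x; elim/quot_ind: y => y.
by rewrite -quot_piM -!quot_piZ -quot_piM scalerAl.
Qed.

Lemma quot_scalerAr (a : K) (x y : quot_alg) : a *: (x * y) = x * (a *: y).
Proof.
elim/quot_ind: x => x; elim/quot_ind: y => y.
by rewrite -quot_piM -!quot_piZ -quot_piM scalerAr.
Qed.

Lemma quot_pi_alg_morphism : alg_morphism quot_pi.
Proof.
split; first by move=> a x y; rewrite quot_piD quot_piZ.
by split=> // x y; rewrite quot_piM.
Qed.

HB.instance Definition _ :=
  GRing.isLinear.Build K A quot_alg _ quot_pi (proj1 quot_pi_alg_morphism).
HB.instance Definition _ :=
  GRing.isMonoidMorphism.Build A quot_alg quot_pi (proj2 quot_pi_alg_morphism).

End Quotient.

Section Skew.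
Variables (K : pzRingType) (gT : finGroupType) (A : algType K).

Record alg_action := AlgAction {
  act_fun :> gT -> A -> A;
  act_morph : forall g, alg_morphism (act_fun g);
  act_id : forall x, act_fun 1%g x = x;
  act_comp : forall g h x, act_fun (g * h)%g x = act_fun g (act_fun h x)
}.

Variable act : alg_action.

Lemma act_is_linear g : linear (act g). Proof. by case: (act_morph act g). Qed.
Lemma act_is_monoid g : monoid_morphism (act g).
Proof. by case: (act_morph act g). Qed.
HB.instance Definition _ g := GRing.isLinear.Build K A A _ (act g) (@act_is_linear g).
HB.instance Definition _ g :=
  GRing.isMonoidMorphism.Build A A (act g) (@act_is_monoid g).

(* The skew group algebra A#G, the function f standing for \sum_g f(g) t_g. *)
Definition skew_alg of alg_action := {ffun gT -> A}.

HB.instance Definition _ := GRing.Lmodule.copy (skew_alg act) {ffun gT -> A}.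

Definition skew_pure (a : A) (g : gT) : skew_alg act :=
  [ffun k => if k == g then a else 0].

(* (a t_g) (b t_h) = a g(b) t_(gh), collected at k = gh *)
Definition skew_mul (x y : skew_alg act) : skew_alg act :=
  [ffun k => \sum_(g : gT) x g * act g (y (g^-1 * k)%g)].

Lemma skew_addE (x y : skew_alg act) k : (x + y) k = x k + y k.
Proof. exact: ffunE. Qed.

Lemma skew_mulA : associative skew_mul.
Proof.
move=> x y z; apply/ffunP => k; rewrite !ffunE.
under eq_bigr => g _ do rewrite ffunE raddf_sum mulr_sumr.
under [RHS]eq_bigr => h _ do rewrite ffunE mulr_suml.
rewrite [RHS]exchange_big; apply: eq_bigr => g _ /=.
rewrite [RHS](reindex_inj (mulgI g)); apply: eq_bigr => h _ /=.
by rewrite rmorphM /= act_comp mulKg mulrA invMg mulgA.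
Qed.

Lemma skew_mul1 : left_id (skew_pure 1 1) skew_mul.
Proof.
move=> x; apply/ffunP => k; rewrite ffunE (bigD1 1%g) //= big1 => [|g /negPf g1].
  by rewrite ffunE eqxx mul1r act_id invg1 mul1g addr0.
by rewrite ffunE g1 mul0r.
Qed.

Lemma skew_mulr1 : right_id (skew_pure 1 1) skew_mul.
Proof.
move=> x; apply/ffunP => k; rewrite ffunE (bigD1 k) //= big1 => [|g].
  by rewrite ffunE mulVg eqxx rmorph1 mulr1 addr0.
move=> /negPf gk; rewrite ffunE -eq_mulVg1 gk.
by rewrite raddf0 mulr0.
Qed.

Lemma skew_mulDl : left_distributive skew_mul +%R.
Proof.
move=> x y z; apply/ffunP => k; rewrite skew_addE !ffunE -big_split.
by apply: eq_bigr => g _; rewrite skew_addE mulrDl.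
Qed.

Lemma skew_mulDr : right_distributive skew_mul +%R.
Proof.
move=> x y z; apply/ffunP => k; rewrite skew_addE !ffunE -big_split.
by apply: eq_bigr => g _; rewrite skew_addE raddfD mulrDr.
Qed.

Lemma skew_one_neq0 : skew_pure 1 1 != 0.
Proof.
apply/eqP => /ffunP/(_ 1%g)/eqP.
by rewrite !ffunE eqxx oner_eq0.
Qed.

HB.instance Definition _ := GRing.Zmodule_isNzRing.Build (skew_alg act)
  skew_mulA skew_mul1 skew_mulr1 skew_mulDl skew_mulDr skew_one_neq0.

Lemma skew_scalerE (a : K) (x : skew_alg act) k : (a *: x) k = a *: x k.
Proof. exact: ffunE. Qed.

Lemma skew_scalerAl (a : K) (x y : skew_alg act) : a *: (x * y) = (a *: x) * y.
Proof.
apply/ffunP => k; rewrite skew_scalerE !ffunE scaler_sumr.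
by apply: eq_bigr => g _; rewrite skew_scalerE scalerAl.
Qed.

Lemma skew_scalerAr (a : K) (x y : skew_alg act) : a *: (x * y) = x * (a *: y).
Proof.
apply/ffunP => k; rewrite skew_scalerE !ffunE scaler_sumr.
by apply: eq_bigr => g _; rewrite skew_scalerE linearZ scalerAr.
Qed.

HB.instance Definition _ :=
  GRing.Lmodule_isLalgebra.Build K (skew_alg act) skew_scalerAl.
HB.instance Definition _ :=
  GRing.Lalgebra_isAlgebra.Build K (skew_alg act) skew_scalerAr.

Lemma skew_pureM a g b h :
  skew_pure a g * skew_pure b h = skew_pure (a * act g b) (g * h)%g.
Proof.
apply/ffunP => k; rewrite !ffunE (bigD1 g) //= big1 => [|i /negPf ig].
  rewrite !ffunE eqxx addr0 (can2_eq (mulVKg g) (mulKg g)).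
  by case: ifP => // _; rewrite raddf0 mulr0.
by rewrite ffunE ig mul0r.
Qed.

End Skew.

Lemma malg_scalerAr (K : comNzRingType) (G : monomType) (a : K)
    (x y : {malg K[G]}) : a *: (x * y) = x * (a *: y).
Proof.
have comm_aC z : z * a%:MP = a *: z.
  rewrite malgM_def malgZ_def fgmulgU.
  by apply: eq_bigr => k _; rewrite mulm1 mulrC.
by rewrite -!comm_aC mulrA.
Qed.

Section FreeAlg.
Variables (K : comNzRingType) (I : choiceType).
Local Notation M := {malg K[{fmonom I}]}.

(* K<x_i : i in I> is the monoid algebra of the free monoid on I. The operations
   are those of M, locked because unfolding them makes unification diverge. *)
Definition free_alg := M.
Implicit Types x y z : free_alg.

HB.instance Definition _ := Choice.copy free_alg M.

Fact free_key : unit. Proof. exact: tt. Qed.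
Definition free_zero : free_alg := locked_with free_key (0 : M).
Definition free_one : free_alg := locked_with free_key (1 : M).
Definition free_opp : free_alg -> free_alg :=
  locked_with free_key (fun x => - (x : M)).
Definition free_add : free_alg -> free_alg -> free_alg :=
  locked_with free_key (fun x y => (x : M) + (y : M)).
Definition free_mul : free_alg -> free_alg -> free_alg :=
  locked_with free_key (fun x y => (x : M) * (y : M)).
Definition free_scale : K -> free_alg -> free_alg :=
  locked_with free_key (fun a x => a *: (x : M)).
Definition free_gen : I -> free_alg :=
  locked_with free_key (fun i => << fmu i >> : M).

Lemma free_zeroE : free_zero = (0 : M).
Proof. by rewrite /free_zero; case: free_key. Qed.
Lemma free_oneE : free_one = (1 : M).
Proof. by rewrite /free_one; case: free_key. Qed.
Lemma free_oppE x : free_opp x = - (x : M).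
Proof. by rewrite /free_opp; case: free_key. Qed.
Lemma free_addE x y : free_add x y = (x : M) + (y : M).
Proof. by rewrite /free_add; case: free_key. Qed.
Lemma free_mulE x y : free_mul x y = (x : M) * (y : M).
Proof. by rewrite /free_mul; case: free_key. Qed.
Lemma free_scaleE a x : free_scale a x = a *: (x : M).
Proof. by rewrite /free_scale; case: free_key. Qed.
Lemma free_genE i : free_gen i = (<< fmu i >> : M).
Proof. by rewrite /free_gen; case: free_key. Qed.

Lemma free_addA : associative free_add.
Proof. by move=> x y z; rewrite !free_addE addrA. Qed.
Lemma free_addC : commutative free_add.
Proof. by move=> x y; rewrite !free_addE addrC. Qed.
Lemma free_add0 : left_id free_zero free_add.
Proof. by move=> x; rewrite free_addE free_zeroE add0r. Qed.
Lemma free_addN : left_inverse free_zero free_opp free_add.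
Proof. by move=> x; rewrite free_addE free_zeroE free_oppE addNr. Qed.

HB.instance Definition _ :=
  GRing.isZmodule.Build free_alg free_addA free_addC free_add0 free_addN.

Lemma malg_addE x y : x + y = (x : M) + (y : M). Proof. exact: free_addE. Qed.
Lemma malg_zeroE : (0 : free_alg) = (0 : M). Proof. exact: free_zeroE. Qed.

Lemma free_mulA : associative free_mul.
Proof. by move=> x y z; rewrite !free_mulE mulrA. Qed.
Lemma free_mul1 : left_id free_one free_mul.
Proof. by move=> x; rewrite free_mulE free_oneE mul1r. Qed.
Lemma free_mulr1 : right_id free_one free_mul.
Proof. by move=> x; rewrite free_mulE free_oneE mulr1. Qed.
Lemma free_mulDl : left_distributive free_mul +%R.
Proof. by move=> x y z; rewrite !malg_addE !free_mulE mulrDl. Qed.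
Lemma free_mulDr : right_distributive free_mul +%R.
Proof. by move=> x y z; rewrite !malg_addE !free_mulE mulrDr. Qed.
Lemma free_one_neq0 : free_one != 0.
Proof. by rewrite malg_zeroE free_oneE oner_neq0. Qed.

HB.instance Definition _ := GRing.Zmodule_isNzRing.Build free_alg
  free_mulA free_mul1 free_mulr1 free_mulDl free_mulDr free_one_neq0.

Lemma malg_mulE x y : x * y = (x : M) * (y : M). Proof. exact: free_mulE. Qed.
Lemma malg_oneE : (1 : free_alg) = (1 : M). Proof. exact: free_oneE. Qed.

Lemma free_scaleA a b x : free_scale a (free_scale b x) = free_scale (a * b) x.
Proof. by rewrite !free_scaleE scalerA. Qed.
Lemma free_scale1 : left_id 1 free_scale.
Proof. by move=> x; rewrite free_scaleE scale1r. Qed.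
Lemma free_scaleDr : right_distributive free_scale +%R.
Proof. by move=> a x y; rewrite !malg_addE !free_scaleE scalerDr. Qed.
Lemma free_scaleDl x : {morph free_scale^~ x : a b / a + b}.
Proof. by move=> a b; rewrite malg_addE !free_scaleE scalerDl. Qed.

HB.instance Definition _ := GRing.Zmodule_isLmodule.Build K free_alg
  free_scaleA free_scale1 free_scaleDr free_scaleDl.

Lemma malg_scaleE a x : a *: x = a *: (x : M). Proof. exact: free_scaleE. Qed.

Lemma free_scalerAl (a : K) x y : a *: (x * y) = (a *: x) * y.
Proof. by rewrite !malg_mulE !malg_scaleE scalerAl. Qed.

Lemma free_scalerAr (a : K) x y : a *: (x * y) = x * (a *: y).
Proof.
by rewrite !malg_mulE !malg_scaleE malg_scalerAr.
Qed.

HB.instance Definition _ :=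
  GRing.Lmodule_isLalgebra.Build K free_alg free_scalerAl.
HB.instance Definition _ :=
  GRing.Lalgebra_isAlgebra.Build K free_alg free_scalerAr.

Section Lift.
Variables (B : algType K) (f : I -> B).

Definition lift_mon (m : {fmonom I}) : B := \prod_(i <- m) f i.

Lemma lift_mon_morph : mmorphism lift_mon.
Proof.
split=> [m n|]; last by rewrite /lift_mon fm1 big_nil.
by rewrite /lift_mon fmM big_cat.
Qed.
HB.instance Definition _ := isMultiplicative.Build _ _ lift_mon lift_mon_morph.

(* The algebra morphism sending x_i to f i. *)
Definition free_lift (x : free_alg) : B := mmap (in_alg B) lift_mon x.

Lemma free_lift_morph : alg_morphism free_lift.
Proof.
split=> [a x y|].
  by rewrite /free_lift malg_addE raddfD /= malg_scaleE mmapZ /= mulr_algl.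
have fM : multiplicative (mmap (in_alg B) lift_mon).
  apply: commr_mmap_is_multiplicative => g m m'.
  by rewrite /GRing.comm /= mulr_algl mulr_algr.
split=> [|x y]; first by rewrite /free_lift malg_oneE; case: fM.
by rewrite /free_lift malg_mulE; case: fM.
Qed.

Lemma free_lift_gen i : free_lift (free_gen i) = f i.
Proof.
by rewrite /free_lift free_genE mmapU /= scale1r mul1r /lift_mon fmuE big_seq1.
Qed.

End Lift.
End FreeAlg.
Arguments free_gen K {I} i.

Lemma alg_morphism_sum (K : pzRingType) (A B : algType K) (f : A -> B) :
  alg_morphism f -> forall (T : Type) (r : seq T) (F : T -> A),
  f (\sum_(i <- r) F i) = \sum_(i <- r) f (F i).
Proof.
case=> fl _ T r F; have f0 : f 0 = 0.
  by rewrite -[X in f X](subrr 0) -scaleN1r addrC fl scaleN1r addNr.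
elim: r => [|i r IH]; first by rewrite !big_nil.
by rewrite !big_cons -IH -[F i in LHS]scale1r fl scale1r.
Qed.

Lemma free_morph_ext (K : comNzRingType) (I : choiceType) (B : algType K)
    (f g : free_alg K I -> B) :
  alg_morphism f -> alg_morphism g ->
  (forall i, f (free_gen K i) = g (free_gen K i)) -> f =1 g.
Proof.
move=> fm gm fg x.
pose mon (m : {fmonom I}) : free_alg K I := << m >>.
have xE : x = \sum_(m <- msupp x) mcoeff m x *: mon m.
  rewrite {1}[x]monalgE.
  have -> (s : seq {fmonom I}) : \sum_(m <- s) mcoeff m x *: mon m =
      \sum_(m <- s) << mcoeff m x *g m >> :> {malg K[{fmonom I}]}.
    elim: s => [|m s IH]; first by rewrite !big_nil malg_zeroE.
    rewrite !big_cons malg_addE IH malg_scaleE; congr (_ + _).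
    by apply/malgP => k; rewrite mcoeffZ !mcoeffU mulrnAr mulr1.
  by [].
have monE (h : free_alg K I -> B) : alg_morphism h -> forall m,
    h (mon m) = \prod_(i <- m) h (free_gen K i).
  case=> hl [h1 hM]; case; elim=> [|i s IH] /=.
    rewrite big_nil -h1 malg_oneE; congr (h _).
    by rewrite /mon -fmoneE.
  rewrite big_cons -IH -hM; congr (h _); rewrite malg_mulE free_genE.
  rewrite malgM_def fgmulUU mulr1 /mon; congr << _ >>.
  by apply: val_inj; rewrite /= fmM fmuE.
rewrite xE (alg_morphism_sum fm) (alg_morphism_sum gm); apply: eq_bigr => m _.
have hZ (h : free_alg K I -> B) : alg_morphism h -> forall a y, h (a *: y) = a *: h y.
  case=> hl _ a y; have h0 : h 0 = 0.
    by rewrite -[X in h X](subrr 0) -scaleN1r addrC hl scaleN1r addNr.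
  by rewrite -[a *: y]addr0 hl h0 addr0.
rewrite !hZ // !monE //; congr (_ *: _); apply: eq_bigr => i _; exact: fg.
Qed.

Section QuantumDrinfeldHecke.
Variables (K : fieldType) (gT : finGroupType).
Variable rho : mx_representation K [set: gT]%G 2.

(* v_1, v_2 in K<v_1,v_2> *)
Definition fv (i : 'I_2) : free_alg K 'I_2 := free_gen K i.

(* The action of G on K<v_1,v_2> extending its linear action on V; the columns
   of rho g are the coordinates of g(v_1) and g(v_2). *)
Definition free_act (g : gT) : free_alg K 'I_2 -> free_alg K 'I_2 :=
  free_lift (fun j => \sum_(i < 2) rho g i j *: fv i).

Lemma free_act_morph g : alg_morphism (free_act g).
Proof. exact: free_lift_morph. Qed.

Lemma free_act_id x : free_act 1%g x = x.
Proof.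
apply: (free_morph_ext (f := free_act 1%g) (g := id)) x => [||i].
- exact: free_act_morph.
- by split.
rewrite /free_act free_lift_gen repr_mx1 (bigD1 i) //= big1 => [|j /negPf ji].
  by rewrite mxE eqxx scale1r addr0.
by rewrite mxE ji scale0r.
Qed.

Lemma free_act_comp g h x : free_act (g * h)%g x = free_act g (free_act h x).
Proof.
apply: (free_morph_ext (f := free_act (g * h)%g)
  (g := fun x => free_act g (free_act h x))) x => [||j].
- exact: free_act_morph.
- have [gl [g1 gM]] := free_act_morph g; have [hl [h1 hM]] := free_act_morph h.
  by split=> [a x y|]; [rewrite hl gl|split=> [|x y]; rewrite ?hM ?gM ?h1 ?g1].
have [gl _] := free_act_morph g.
have gZ a x : free_act g (a *: x) = a *: free_act g x.
  have g0 : free_act g 0 = 0.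
    by rewrite -[X in free_act g X](subrr 0) -scaleN1r addrC gl scaleN1r addNr.
  by rewrite -[a *: x]addr0 gl g0 addr0.
rewrite {1}/free_act [free_act h _]free_lift_gen free_lift_gen.
rewrite (alg_morphism_sum (free_act_morph g)) repr_mxM ?inE //.
under [RHS]eq_bigr => k _ do
  rewrite gZ [free_act g _]free_lift_gen scaler_sumr.
rewrite exchange_big; apply: eq_bigr => i _ /=.
by rewrite mxE scaler_suml; apply: eq_bigr => k _; rewrite scalerA mulrC.
Qed.

Definition free_action : alg_action gT (free_alg K 'I_2) :=
  AlgAction free_act_morph free_act_id free_act_comp.

(* Generators: inl i is v_i, inr g is t_g. *)
Definition hgen := ('I_2 + gT)%type.
Definition hv (i : 'I_2) : free_alg K hgen := free_gen K (inl i : hgen).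
Definition ht (g : gT) : free_alg K hgen := free_gen K (inr g : hgen).
Definition hvec (v : 'cV[K]_2) : free_alg K hgen := \sum_i v i 0 *: hv i.
(* Elements of KG are given by their coefficients. *)
Definition hgrp (k : {ffun gT -> K}) : free_alg K hgen := \sum_g k g *: ht g.

Inductive hrel (Q : 'M[K]_2) (kappa : 'I_2 -> 'I_2 -> {ffun gT -> K}) :
    free_alg K hgen -> Prop :=
| HrelOne : hrel Q kappa (ht 1%g - 1)
| HrelMul g h : hrel Q kappa (ht g * ht h - ht (g * h)%g)
| HrelAct g v : hrel Q kappa (ht g * hvec v - hvec (rho g *m v) * ht g)
| HrelComm i j : hrel Q kappa
    (hv j * hv i - (Q i j *: (hv i * hv j) + hgrp (kappa i j))).

Implicit Types (Q : 'M[K]_2) (kappa : 'I_2 -> 'I_2 -> {ffun gT -> K}).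

Definition hecke_alg Q kappa := quot_alg (hrel Q kappa).
Definition hecke_pi Q kappa : free_alg K hgen -> hecke_alg Q kappa :=
  quot_pi (hrel Q kappa).

Definition is_qdh Q kappa : Prop :=
  (forall i j, Q i j != 0) /\
  is_basis (fun m : (nat * nat * gT)%type =>
    hecke_pi Q kappa (hv 0 ^+ m.1.1 * hv 1 ^+ m.1.2 * ht m.2)).

Definition qcomm (q : K) : free_alg K 'I_2 :=
  fv 1 * fv 0 - q *: (fv 0 * fv 1).

Definition skew_free := skew_alg free_action.
Definition skew_rel (q : K) (w : skew_free) (x : skew_free) : Prop :=
  x = skew_pure free_action (qcomm q) 1 - w.
(* K<v_1,v_2>#G / < v_2 v_1 - q v_1 v_2 - w > *)
Definition skew_quot (q : K) (w : skew_free) := quot_alg (skew_rel q w).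
Definition skew_quot_v q w (i : 'I_2) : skew_quot q w :=
  quot_pi (skew_rel q w) (skew_pure free_action (fv i) 1).
Definition skew_quot_t q w (g : gT) : skew_quot q w :=
  quot_pi (skew_rel q w) (skew_pure free_action 1 g).

(* H_(Q,kappa) is this quotient, with the same generators. *)
Definition hecke_skew_quot Q kappa q w :=
  exists f : hecke_alg Q kappa -> skew_quot q w,
    [/\ alg_iso f, forall i, f (hecke_pi Q kappa (hv i)) = skew_quot_v q w i
      & forall g, f (hecke_pi Q kappa (ht g)) = skew_quot_t q w g].

Definition skew_sum (D : {set gT}) (c : {ffun gT -> K}) : skew_free :=
  \sum_(g in D) c g *: skew_pure free_action 1 g.

(* The quantum Drinfeld Hecke algebras with q_12 = q are exactly the quotients
   of K<v_1,v_2>#G by v_2 v_1 - q v_1 v_2 - \sum_(g in D) c_g t_g, P c. *)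
Definition qdh_comprises (q : K) (D : {set gT}) (P : {ffun gT -> K} -> Prop) :=
  (forall Q kappa, Q 0 1 = q -> is_qdh Q kappa ->
     exists2 c, P c & hecke_skew_quot Q kappa q (skew_sum D c)) /\
  (forall c, P c -> exists Q kappa,
     [/\ Q 0 1 = q, is_qdh Q kappa & hecke_skew_quot Q kappa q (skew_sum D c)]).

Definition twisted (chi : gT -> K) (D : {set gT}) (c : {ffun gT -> K}) :=
  forall g h, g \in D -> c (h^-1 * g * h)%g = chi h * c g.

Definition class_reps (D X : {set gT}) :=
  is_transversal X [set (g ^: [set: gT])%g | g in D] D.

(* Twisted coefficients can be prescribed arbitrarily, and in only one way, on
   class representatives, up to the compatibility with centralizers. *)
Definition arbitrary_on_reps (chi : gT -> K) (D : {set gT}) :=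
  forall (X : {set gT}) (d : gT -> K), class_reps D X ->
    (forall x, x \in X -> d x = 0 \/ (forall h, h \in 'C[x]%g -> chi h = 1)) ->
  exists c, [/\ twisted chi D c, {in X, c =1 d}
    & forall c', twisted chi D c' -> {in X, c' =1 d} -> {in D, c' =1 c}].

Definition detQ (q : K) (A : 'M[K]_2) : K := A 0 0 * A 1 1 - q * (A 0 1 * A 1 0).

Definition sq_rel (q : K) (x : free_alg K 'I_2) : Prop := x = qcomm q.
(* S_Q(V) *)
Definition sq_alg (q : K) := quot_alg (sq_rel q).

HB.instance Definition _ q := GRing.Lmodule.on (sq_alg q).
HB.instance Definition _ q := GRing.PzRing.on (sq_alg q).

Lemma sq_one_neq0 q : 1 != 0 :> sq_alg q.
Proof.
apply/eqP => /quot_piP; rewrite subr0.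
have [evl [ev1 evM]] := free_lift_morph (fun _ : 'I_2 => 0 : K^o).
have evX := free_lift_gen (fun _ : 'I_2 => 0 : K^o).
move: (free_lift _) evl ev1 evM evX => ev evl ev1 evM evX.
have evD x y : ev (x - y) = ev x - ev y.
  by rewrite addrC -scaleN1r evl scaleN1r addrC.
have ev0 : ev 0 = 0 by rewrite -(subrr 0) evD subrr.
have evZ a x : ev (a *: x) = a *: ev x by rewrite -[a *: x]addr0 evl ev0 addr0.
move=> J1; have /eqP : ev 1 = 0; last by rewrite ev1 oner_eq0.
apply: (J1 (fun x => ev x = 0)).
  split=> [|x y x0 y0|a x x0|a x x0]; rewrite ?ev0 ?evD ?evM ?x0 ?y0 ?subrr ?mulr0 ?mul0r //.
by move=> y ->; rewrite /qcomm evD evZ !evM !evX !mulr0 scaler0 subrr.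
Qed.

HB.instance Definition _ q :=
  GRing.PzSemiRing_isNonZero.Build (sq_alg q) (sq_one_neq0 q).
HB.instance Definition _ q :=
  GRing.Lmodule_isLalgebra.Build K (sq_alg q) (@quot_scalerAl _ _ (sq_rel q)).
HB.instance Definition _ q :=
  GRing.Lalgebra_isAlgebra.Build K (sq_alg q) (@quot_scalerAr _ _ (sq_rel q)).

Definition sq_v (q : K) (i : 'I_2) : sq_alg q := quot_pi (sq_rel q) (fv i).

Definition induced_action (q : K) (act : alg_action gT (sq_alg q)) :=
  forall g j, act g (sq_v q j) = \sum_i rho g i j *: sq_v q i.

(* H_(Q,kappa) is S_Q(V)#G, with the same generators. *)
Definition hecke_smash Q kappa q :=
  exists act : alg_action gT (sq_alg q), induced_action act /\
  exists f : hecke_alg Q kappa -> skew_alg act,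
    [/\ alg_iso f,
        forall i, f (hecke_pi Q kappa (hv i)) = skew_pure act (sq_v q i) 1%g
      & forall g, f (hecke_pi Q kappa (ht g)) = skew_pure act 1 g].

Definition acts_diagonally := forall g, is_diag_mx (rho g).

Definition acts_monomially := forall g : gT,
  (forall i, #|[set j | rho g i j != 0]| = 1%N) /\
  (forall j, #|[set i | rho g i j != 0]| = 1%N).

End QuantumDrinfeldHecke.

(* Main.v *)
Require Import Defs.
From HB Require Import structures.
From mathcomp Require Import all_boot all_order all_algebra all_fingroup.
From mathcomp Require Import mxrepresentation generic_quotient boolp.
From mathcomp Require Import finmap monalg ring zify.

Set Implicit Arguments.
Unset Strict Implicit.
Unset Printing Implicit Defensive.

Import GRing.Theory.
Local Open Scope ring_scope.

(* Write h(v_0) = a v_0 + c v_1 and h(v_1) = b v_0 + d v_1. Conjugating the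
   relation v_1 v_0 = q v_0 v_1 + kappa by t_h and rewriting the result in normal
   form gives
     (1-q) ab v_0^2 + (1-q^2) bc v_0 v_1 + (1-q) cd v_1^2
       + detQ(h) kappa - t_h kappa t_h^-1 = 0,
   so independence of the monomials v_0^i v_1^j t_g forces the coefficients to
   vanish. For q = 1 only kappa is constrained; otherwise ab = cd = 0 makes G
   monomial, and bc = 0 makes it diagonal if moreover q^2 <> 1.
   Conversely, under these conditions the vector space on the v_0^i v_1^j t_g is a
   right module over the algebra, in which 1 . (v_0^i v_1^j t_g) is the basis
   vector v_0^i v_1^j t_g; hence the monomials are independent. They span because
   the module maps to the algebra compatibly with right multiplication by the
   generators. The identifications with quotients of K<v_0,v_1>#G and with
   S_Q(V)#G hold because all these algebras have the same universal property. *)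

(** * Quotients and skew group algebras *)

Section AlgMorphism.
Variables (K : pzRingType) (A B : algType K) (f : A -> B).
Hypothesis fm : alg_morphism f.

Lemma alg_morphD x y : f (x + y) = f x + f y.
Proof. by rewrite -[x in LHS]scale1r fm.1 scale1r. Qed.

Lemma alg_morph0 : f 0 = 0.
Proof. by apply: (addrI (f 0)); rewrite -alg_morphD !addr0. Qed.

Lemma alg_morphZ a x : f (a *: x) = a *: f x.
Proof. by rewrite -[a *: x]addr0 fm.1 alg_morph0 addr0. Qed.

Lemma alg_morphB x y : f (x - y) = f x - f y.
Proof. by rewrite -scaleN1r alg_morphD alg_morphZ scaleN1r. Qed.

Lemma alg_morphM x y : f (x * y) = f x * f y.
Proof. by case: fm => _ [_ ->]. Qed.

Lemma alg_morph1 : f 1 = 1.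
Proof. by case: fm => _ [->]. Qed.

Lemma alg_morphX x n : f (x ^+ n) = f x ^+ n.
Proof. by elim: n => [|n IH]; rewrite ?alg_morph1 // !exprS alg_morphM IH. Qed.

(** The kernel of [f] is a two-sided ideal, so it contains the ideal generated by [S]. *)
Lemma alg_morph_ideal (S : A -> Prop) : (forall x, S x -> f x = 0) ->
  forall x, ideal_gen S x -> f x = 0.
Proof.
move=> fS x Jx; apply: (Jx (fun y => f y = 0) _ fS).
split=> [|y z y0 z0|a y y0|a y y0].
- exact: alg_morph0.
- by rewrite alg_morphB y0 z0 subrr.
- by rewrite alg_morphM y0 mulr0.
- by rewrite alg_morphM y0 mul0r.
Qed.

End AlgMorphism.

Lemma alg_morphism_comp (K : pzRingType) (A B C : algType K) (f : A -> B) (g : B -> C) :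
  alg_morphism f -> alg_morphism g -> alg_morphism (g \o f).
Proof.
move=> fm gm; split=> [a x y|]; first by rewrite /= fm.1 gm.1.
split=> [|x y] /=; first by rewrite !alg_morph1.
by rewrite !alg_morphM.
Qed.

Lemma alg_morphism_id (K : pzRingType) (A : algType K) : alg_morphism (@id A).
Proof. by []. Qed.

Section NonzeroQuotient.
Variables (K : pzRingType) (A : algType K) (S : A -> Prop).

(** [quot_alg] may be the zero ring, hence is no [algType]. Carrying a proof of 1 != 0 in the type
    gives a copy that is one and can be source or target of an [alg_morphism]. *)
Definition nz_quot of (1 : quot_alg S) != 0 := quot_alg S.

Variable nz : (1 : quot_alg S) != 0.

HB.instance Definition _ := GRing.Lmodule.on (nz_quot nz).
HB.instance Definition _ := GRing.PzRing.on (nz_quot nz).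
HB.instance Definition _ := GRing.PzSemiRing_isNonZero.Build (nz_quot nz) nz.
HB.instance Definition _ :=
  GRing.Lmodule_isLalgebra.Build K (nz_quot nz) (@quot_scalerAl _ _ S).
HB.instance Definition _ :=
  GRing.Lalgebra_isAlgebra.Build K (nz_quot nz) (@quot_scalerAr _ _ S).

Definition nz_pi : A -> nz_quot nz := quot_pi S.

Lemma nz_pi_morphism : alg_morphism nz_pi.
Proof. exact: quot_pi_alg_morphism. Qed.

Lemma nz_pi_rel x : S x -> nz_pi x = 0.
Proof.
move=> Sx; rewrite -(alg_morph0 nz_pi_morphism).
by apply/quot_piP; rewrite subr0 => I _; apply.
Qed.

Section Lift.
Variables (B : algType K) (f : A -> B).
Hypothesis fm : alg_morphism f.
Hypothesis fS : forall x, S x -> f x = 0.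

(** The choice of representative is harmless because [f] vanishes on the ideal. *)
Definition nz_lift (x : nz_quot nz) : B := f (repr (x : quot_alg S)).

Lemma nz_lift_pi x : nz_lift (nz_pi x) = f x.
Proof.
rewrite /nz_lift; apply/eqP; rewrite -subr_eq0 -(alg_morphB fm); apply/eqP.
apply: (alg_morph_ideal fm fS); exact: quot_repr_pi.
Qed.

Lemma nz_lift_morphism : alg_morphism nz_lift.
Proof.
have pim := nz_pi_morphism; split=> [a|].
  elim/quot_ind=> x; elim/quot_ind=> y.
  by rewrite -!/(nz_pi _) -pim.1 !nz_lift_pi fm.1.
split=> [|]; first by rewrite -(alg_morph1 pim) nz_lift_pi alg_morph1.
elim/quot_ind=> x; elim/quot_ind=> y.
by rewrite -!/(nz_pi _) -(alg_morphM pim) !nz_lift_pi alg_morphM.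
Qed.

End Lift.
End NonzeroQuotient.

(** Such an [f] kills the whole ideal but not 1, its target being nonzero. *)
Lemma quot_one_neq0 (K : pzRingType) (A B : algType K) (S : A -> Prop) (f : A -> B) :
  alg_morphism f -> (forall x, S x -> f x = 0) -> (1 : quot_alg S) != 0.
Proof.
move=> fm fS; apply/eqP => /quot_piP; rewrite subr0 => /(alg_morph_ideal fm fS).
by rewrite alg_morph1 // => /eqP; rewrite oner_eq0.
Qed.

Section SkewLift.
Variables (K : pzRingType) (gT : finGroupType) (A B : algType K).
Variable act : alg_action gT A.
Local Notation pure := (skew_pure act).

Lemma skew_pureE a g k : pure a g k = if k == g then a else 0.
Proof. exact: ffunE. Qed.

Lemma skew_pure_morphism : alg_morphism (pure^~ 1%g : A -> skew_alg act).
Proof.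
split=> [a x y|].
  apply/ffunP=> k; rewrite skew_addE skew_scalerE !skew_pureE.
  by case: ifP; rewrite ?scaler0 ?addr0.
by split=> // x y; rewrite skew_pureM act_id mulg1.
Qed.

Lemma skew_sumE (x : skew_alg act) : x = \sum_g pure (x g) g.
Proof.
apply/ffunP=> k.
have sumE (F : gT -> skew_alg act) : (\sum_g F g) k = \sum_g F g k.
  by elim/big_rec2: _ => [|g y1 y2 _ <-]; rewrite ?ffunE // skew_addE.
rewrite sumE (bigD1 k) //= big1 => [|g /negPf gk]; rewrite skew_pureE ?eqxx ?addr0 //.
by rewrite eq_sym gk.
Qed.

Lemma skew_pure_split a g : pure a g = pure a 1%g * pure 1 g.
Proof. by rewrite skew_pureM act_id mulr1 mul1g. Qed.

Lemma skew_morph_ext (f f' : skew_alg act -> B) :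
  alg_morphism f -> alg_morphism f' ->
  (forall a, f (pure a 1%g) = f' (pure a 1%g)) ->
  (forall g, f (pure 1 g) = f' (pure 1 g)) -> f =1 f'.
Proof.
move=> fm fm' fA fG x; rewrite (skew_sumE x) !alg_morphism_sum //.
by apply: eq_bigr => g _; rewrite skew_pure_split !alg_morphM // fA fG.
Qed.

Variables (L : A -> B) (t : gT -> B).
Hypotheses (Lm : alg_morphism L) (t1 : t 1%g = 1).
Hypothesis tM : forall g h, t g * t h = t (g * h)%g.
Hypothesis tL : forall g a, t g * L a = L (act g a) * t g.

(** The universal property of A#G: a morphism L on A and a multiplicative t on G extend jointly to
    A#G once they are covariant, t_g L(a) = L(g(a)) t_g. *)
Definition skew_lift (x : skew_alg act) : B := \sum_g L (x g) * t g.

Lemma skew_lift_pure a g : skew_lift (pure a g) = L a * t g.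
Proof.
rewrite /skew_lift (bigD1 g) //= big1 => [|k /negPf kg].
  by rewrite skew_pureE eqxx addr0.
by rewrite skew_pureE kg (alg_morph0 Lm) mul0r.
Qed.

Lemma skew_lift_morphism : alg_morphism skew_lift.
Proof.
have Ll : linear skew_lift.
  move=> a x y; rewrite /skew_lift scaler_sumr -big_split.
  apply: eq_bigr => g _ /=.
  by rewrite skew_addE skew_scalerE Lm.1 mulrDl scalerAl.
split=> //; have LD x y : skew_lift (x + y) = skew_lift x + skew_lift y.
  by rewrite -[x in LHS]scale1r Ll scale1r.
have L0 : skew_lift 0 = 0 by apply: (addrI (skew_lift 0)); rewrite -LD !addr0.
split=> [|x y]; first by rewrite [skew_lift 1]skew_lift_pure t1 mulr1 (alg_morph1 Lm).
rewrite (skew_sumE x) (skew_sumE y) mulr_suml !(big_morph _ LD L0) mulr_suml.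
apply: eq_bigr => g _; rewrite mulr_sumr !(big_morph _ LD L0) mulr_sumr.
apply: eq_bigr => h _; rewrite skew_pureM !skew_lift_pure (alg_morphM Lm).
by rewrite -!mulrA; congr (_ * _); rewrite [RHS]mulrA tL -mulrA tM.
Qed.

End SkewLift.

(** * Free modules and their endomorphisms *)

Section LinearExtension.
Variables (K : fieldType) (T : choiceType).
Local Notation M := {malg K[T]}.

(* [bas] and [ext] are opaque, since unfolding them makes unification diverge. *)
Fact bas_subproof : {f : T -> M | forall k, f k = << k >>}.
Proof. by exists (fun k => << k >>). Qed.
Definition bas : T -> M := sval bas_subproof.

Lemma basE k : bas k = << k >>.
Proof. exact: (svalP bas_subproof). Qed.

Lemma mcoeff_bas k k' : mcoeff k' (bas k) = (k == k')%:R.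
Proof. by rewrite basE mcoeffU. Qed.

Section Ext.
Variable V : lmodType K.

Fact ext_subproof : {f : (T -> V) -> M -> V |
  forall phi x, f phi x = \sum_(k <- msupp x) mcoeff k x *: phi k}.
Proof. by eexists; move=> phi x. Qed.
Definition ext : (T -> V) -> M -> V := sval ext_subproof.

Variable phi : T -> V.

Lemma extE x : ext phi x = \sum_(k <- msupp x) mcoeff k x *: phi k.
Proof. exact: (svalP ext_subproof). Qed.

Lemma ext_sub (d : {fset T}) (x : M) : (msupp x `<=` d)%fset ->
  ext phi x = \sum_(k <- d) mcoeff k x *: phi k.
Proof.
move=> le; rewrite extE (big_fset_incl _ le) //= => k _.
by rewrite -mcoeff_eq0 => /eqP ->; rewrite scale0r.
Qed.

Lemma ext_is_linear : linear (ext phi).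
Proof.
move=> a x y; pose d := (msupp x `|` msupp y `|` msupp (a *: x + y))%fset.
have [dx dy dz] : [/\ msupp x `<=` d, msupp y `<=` d & msupp (a *: x + y) `<=` d]%fset.
  by split; apply/fsubsetP => k kx; rewrite !in_fsetU kx ?orbT.
rewrite (ext_sub dx) (ext_sub dy) (ext_sub dz) scaler_sumr -big_split.
by apply: eq_bigr => k _ /=; rewrite mcoeffD mcoeffZ scalerDl scalerA.
Qed.

HB.instance Definition _ := GRing.isLinear.Build K M V _ (ext phi) ext_is_linear.

Lemma ext_bas k : ext phi (bas k) = phi k.
Proof. by rewrite extE basE msuppU oner_eq0 big_seq_fset1 -basE mcoeff_bas eqxx scale1r. Qed.

End Ext.

(** Made inductive so that an identity or a bound for linear maps need be checked only on the
    vectors [b k] with [P k]. *)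
Inductive lspan (V : lmodType K) (P : T -> Prop) (b : T -> V) : V -> Prop :=
| lspan_gen k : P k -> lspan P b (b k)
| lspan0 : lspan P b 0
| lspanD x y : lspan P b x -> lspan P b y -> lspan P b (x + y)
| lspanZ a x : lspan P b x -> lspan P b (a *: x).

Lemma lspan_sum (V : lmodType K) P (b : T -> V) (I : Type) (r : seq I) (F : I -> V) :
  (forall i, lspan P b (F i)) -> lspan P b (\sum_(i <- r) F i).
Proof. by move=> bF; elim/big_ind: _ => //; [apply: lspan0|apply: lspanD]. Qed.

Lemma lspan_linear (V W : lmodType K) P (b : T -> V) (Q : W -> Prop)
    (f : {linear V -> W}) :
  Q 0 -> (forall x y, Q x -> Q y -> Q (x + y)) -> (forall a x, Q x -> Q (a *: x)) ->
  (forall k, P k -> Q (f (b k))) -> forall x, lspan P b x -> Q (f x).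
Proof.
move=> Q0 QD QZ Qb x; elim=> [||y z _ Qy _ Qz|a y _ Qy]; rewrite ?linear0 //.
- by rewrite linearD; apply: QD.
- by rewrite linearZ; apply: QZ.
Qed.

Lemma lspan_sub (V W : lmodType K) P P' (b : T -> V) (b' : T -> W)
    (f : {linear V -> W}) :
  (forall k, P k -> lspan P' b' (f (b k))) ->
  forall x, lspan P b x -> lspan P' b' (f x).
Proof.
move=> H; apply: lspan_linear => //; [exact: lspan0|exact: lspanD|exact: lspanZ].
Qed.

Lemma lspan_eq (V W : lmodType K) P (b : T -> V) (f g : {linear V -> W}) :
  (forall k, P k -> f (b k) = g (b k)) -> forall x, lspan P b x -> f x = g x.
Proof.
move=> H x; elim=> [||y z _ Qy _ Qz|a y _ Qy]; rewrite ?linear0 //.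
- by rewrite !linearD Qy Qz.
- by rewrite !linearZ /= Qy.
Qed.

(** Meant for maps such as [fun x => f x * y], whose linearity is a proof rather than a canonical
    instance. *)
Lemma lspan_fun_eq (V W : lmodType K) P (b : T -> V) (f g : V -> W) :
  linear f -> linear g -> (forall k, P k -> f (b k) = g (b k)) ->
  forall x, lspan P b x -> f x = g x.
Proof.
move=> fl gl; pose F := HB.pack_for {linear V -> W} f (GRing.isLinear.Build _ _ _ _ f fl).
pose G := HB.pack_for {linear V -> W} g (GRing.isLinear.Build _ _ _ _ g gl).
exact: (@lspan_eq V W P b F G).
Qed.

Lemma lspan_bas (x : M) : lspan (fun=> True) bas x.
Proof.
rewrite (monalgE x); elim/big_ind: _ => [||k _]; [exact: lspan0|exact: lspanD|].
have -> : << mcoeff k x *g k >> = mcoeff k x *: bas k.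
  by rewrite basE; apply/malgP => k'; rewrite mcoeffZ !mcoeffU mulrnAr mulr1.
exact/lspanZ/lspan_gen.
Qed.

Lemma malg_linear_ext (V : lmodType K) (f g : {linear M -> V}) :
  (forall k, f (bas k) = g (bas k)) -> f =1 g.
Proof. by move=> fg x; apply: (lspan_eq _ (lspan_bas x)). Qed.

Lemma malg_fun_ext (V : lmodType K) (f g : M -> V) : linear f -> linear g ->
  (forall k, f (bas k) = g (bas k)) -> f =1 g.
Proof. by move=> fl gl fg x; apply: (lspan_fun_eq fl gl _ (lspan_bas x)). Qed.

(** Independence and spanning are injectivity and surjectivity of a map from the free module, where
    coefficients can be read off by [mcoeff]. *)
Lemma is_basisP (V : lmodType K) (b : T -> V) :
  is_basis b <-> (forall x, ext b x = 0 -> x = 0) /\ (forall v, exists x, v = ext b x).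
Proof.
split=> [[free span]|[inj surj]]; split.
- move=> x x0; apply/malgP => k; rewrite mcoeff0; rewrite extE in x0.
  have [kx|/mcoeff_outdom//] := boolP (k \in msupp x).
  by apply: (free _ _ _ x0) => //; apply: fset_uniq.
- move=> v; have [s [c ->]] := span v; exists (\sum_(i <- s) c i *: bas i).
  by rewrite linear_sum; apply: eq_bigr => i _; rewrite linearZ /= ext_bas.
- move=> s c us sum0 i si.
  have /malgP/(_ i) : \sum_(j <- s) c j *: bas j = 0.
    apply: inj; rewrite linear_sum -[RHS]sum0.
    by apply: eq_bigr => j _; rewrite linearZ /= ext_bas.
  rewrite raddf_sum mcoeff0 (bigD1_seq i) //= big1 => [|j /negPf ji].
    by rewrite mcoeffZ mcoeff_bas eqxx mulr1 addr0.
  by rewrite mcoeffZ mcoeff_bas ji mulr0.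
- move=> v; have [x ->] := surj v.
  by exists (msupp x), (fun k => mcoeff k x); rewrite extE.
Qed.

End LinearExtension.

(* The linear endomorphisms of V with the reversed composition, so that a right
   action of an algebra on V is a morphism to [rend]. *)
Section RightEnd.
Variables (K : fieldType) (V : lmodType K).

Record rend_type := Rend { rend_fun :> V -> V; rend_lin : linear rend_fun }.

Lemma rendP (f g : rend_type) : f =1 g -> f = g.
Proof.
case: f g => [f fl] [g gl] /= /funext fg.
by case: _ / fg in gl *; congr Rend; apply: Prop_irrelevance.
Qed.

(** A nonzero vector keeps the identity apart from 0, as an [algType] requires. *)
Definition rend of exists v : V, v != 0 := rend_type.

Variable nz : exists v : V, v != 0.
Local Notation E := (rend nz).
Implicit Types f g h : E.

HB.instance Definition _ := gen_eqMixin E.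
HB.instance Definition _ := gen_choiceMixin E.

HB.instance Definition _ f := GRing.isLinear.Build K V V _ (f : V -> V) (rend_lin f).

Fact rend0_lin : linear (fun _ : V => 0 : V).
Proof. by move=> a x y; rewrite scaler0 addr0. Qed.
Fact rend1_lin : linear (@id V). Proof. by []. Qed.
Fact rendN_lin f : linear (fun x => - f x).
Proof. by move=> a x y; rewrite rend_lin opprD scalerN. Qed.
Fact rendD_lin f g : linear (fun x => f x + g x).
Proof. by move=> a x y; rewrite !rend_lin scalerDr addrACA. Qed.
Fact rendM_lin f g : linear (fun x => g (f x)).
Proof. by move=> a x y; rewrite !rend_lin. Qed.
Fact rendZ_lin a f : linear (fun x => a *: f x).
Proof. by move=> b x y; rewrite rend_lin scalerDr !scalerA mulrC. Qed.

Definition rend0 : E := Rend rend0_lin.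
Definition rend1 : E := Rend rend1_lin.
Definition rendN f : E := Rend (rendN_lin f).
Definition rendD f g : E := Rend (rendD_lin f g).
Definition rendM f g : E := Rend (rendM_lin f g).
Definition rendZ a f : E := Rend (rendZ_lin a f).

Fact rendDA : associative rendD.
Proof. by move=> f g h; apply/rendP=> x /=; rewrite addrA. Qed.
Fact rendDC : commutative rendD.
Proof. by move=> f g; apply/rendP=> x /=; rewrite addrC. Qed.
Fact rendD0 : left_id rend0 rendD.
Proof. by move=> f; apply/rendP=> x /=; rewrite add0r. Qed.
Fact rendDN : left_inverse rend0 rendN rendD.
Proof. by move=> f; apply/rendP=> x /=; rewrite addNr. Qed.

HB.instance Definition _ := GRing.isZmodule.Build E rendDA rendDC rendD0 rendDN.

Lemma rend_addE f g x : (f + g) x = f x + g x. Proof. by []. Qed.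
Lemma rend_oppE f x : (- f) x = - f x. Proof. by []. Qed.

Fact rendMA : associative rendM.
Proof. by move=> f g h; apply/rendP. Qed.
Fact rend1M : left_id rend1 rendM. Proof. by move=> f; apply/rendP. Qed.
Fact rendM1 : right_id rend1 rendM. Proof. by move=> f; apply/rendP. Qed.
Fact rendMDl : left_distributive rendM +%R.
Proof. by move=> f g h; apply/rendP=> x /=; rewrite linearD. Qed.
Fact rendMDr : right_distributive rendM +%R.
Proof. by move=> f g h; apply/rendP. Qed.
Fact rend1_neq0 : rend1 != 0.
Proof.
case: nz => v /eqP v0; apply/eqP => e; apply: v0.
by rewrite -[LHS]/(rend1 v) e.
Qed.

HB.instance Definition _ := GRing.Zmodule_isNzRing.Build E
  rendMA rend1M rendM1 rendMDl rendMDr rend1_neq0.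

Fact rendZA a b f : rendZ a (rendZ b f) = rendZ (a * b) f.
Proof. by apply/rendP=> x /=; rewrite scalerA. Qed.
Fact rend1Z : left_id 1 rendZ.
Proof. by move=> f; apply/rendP=> x /=; rewrite scale1r. Qed.
Fact rendZDr : right_distributive rendZ +%R.
Proof. by move=> a f g; apply/rendP=> x /=; rewrite scalerDr. Qed.
Fact rendZDl f : {morph rendZ^~ f : a b / a + b}.
Proof. by move=> a b; apply/rendP=> x /=; rewrite scalerDl. Qed.

HB.instance Definition _ := GRing.Zmodule_isLmodule.Build K E
  rendZA rend1Z rendZDr rendZDl.

Fact rendZMl (a : K) f g : a *: (f * g) = (a *: f) * g.
Proof. by apply/rendP=> x /=; rewrite linearZ. Qed.
Fact rendZMr (a : K) f g : a *: (f * g) = f * (a *: g).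
Proof. by apply/rendP. Qed.

HB.instance Definition _ := GRing.Lmodule_isLalgebra.Build K E rendZMl.
HB.instance Definition _ := GRing.Lalgebra_isAlgebra.Build K E rendZMr.

Lemma rend_mulE f g x : (f * g) x = g (f x). Proof. by []. Qed.
Lemma rend_scaleE a f x : (a *: f) x = a *: f x. Proof. by []. Qed.
Lemma rend_sumE (I : Type) (r : seq I) (F : I -> E) x :
  (\sum_(i <- r) F i) x = \sum_(i <- r) F i x.
Proof. by elim/big_rec2: _ => // i y f _ <-. Qed.

End RightEnd.

(** Every element is a linear combination of words, and a word arises from 1 by prepending
    letters. *)
Lemma free_ind (K : comNzRingType) (I : choiceType) (P : free_alg K I -> Prop) :
  P 1 -> (forall x y, P x -> P y -> P (x + y)) ->
  (forall a x, P x -> P (a *: x)) ->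
  (forall i x, P x -> P (free_gen K i * x)) -> forall x, P x.
Proof.
move=> P1 PD PZ PM x.
pose mon (m : {fmonom I}) : free_alg K I := << m >>.
have Pmon m : P (mon m).
  case: m; elim=> [|i s IH].
    suff -> : mon (FMonom [::]) = 1 by [].
    by rewrite malg_oneE /mon -fmoneE.
  suff -> : mon (FMonom (i :: s)) = free_gen K i * mon (FMonom s) by apply: PM.
  rewrite malg_mulE free_genE malgM_def fgmulUU mulr1 /mon; congr << _ >>.
  by apply: val_inj; rewrite /= fmM fmuE.
have P0 : P 0 by rewrite -(scale0r 1); apply: PZ.
have -> : x = \sum_(m <- msupp x) mcoeff m x *: mon m.
  rewrite {1}[x]monalgE.
  have -> (s : seq {fmonom I}) : \sum_(m <- s) mcoeff m x *: mon m =
      \sum_(m <- s) << mcoeff m x *g m >> :> {malg K[{fmonom I}]}.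
    elim: s => [|m s IH]; first by rewrite !big_nil malg_zeroE.
    rewrite !big_cons malg_addE IH malg_scaleE; congr (_ + _).
    by apply/malgP => k; rewrite mcoeffZ !mcoeffU mulrnAr mulr1.
  by [].
by elim/big_ind: _ => // m _; apply/PZ/Pmon.
Qed.

Lemma ord2P (P : 'I_2 -> Prop) : P 0 -> P 1 -> forall i, P i.
Proof.
move=> P0 P1 [[|[|i]] // lti]; [suff -> : Ordinal lti = 0 by []|suff -> : Ordinal lti = 1 by []];
  exact: val_inj.
Qed.

Lemma sum_ord2 (V : nmodType) (F : 'I_2 -> V) : \sum_i F i = F 0 + F 1.
Proof.
rewrite !big_ord_recl big_ord0 addr0; congr (F _ + F _); exact: val_inj.
Qed.

(** Expanding and trading yx for yx - q xy puts the quantum determinant in front; the remaining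
    terms are the obstructions to A preserving the q-commutation relation. *)
Lemma qcomm_subst (K : fieldType) (B : algType K) (q : K) (A : 'M[K]_2) (x y : B) :
  let w j := A 0 j *: x + A 1 j *: y in
  w 1 * w 0 - q *: (w 0 * w 1) =
  detQ q A *: (y * x - q *: (x * y)) +
  (((1 - q) * (A 0 0 * A 0 1)) *: (x * x) +
   ((1 - q ^+ 2) * (A 0 1 * A 1 0)) *: (x * y) +
   ((1 - q) * (A 1 0 * A 1 1)) *: (y * y)).
Proof.
(* A combination of the words xx, xy, yx, yy is stored by its coefficients, which leaves four
   identities in K. *)
pose cmb (c1 c2 c3 c4 : K) := (c1 *: (x * x) + c2 *: (x * y)) + (c3 *: (y * x) + c4 *: (y * y)).
have cmbD c1 c2 c3 c4 d1 d2 d3 d4 : cmb c1 c2 c3 c4 + cmb d1 d2 d3 d4 =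
    cmb (c1 + d1) (c2 + d2) (c3 + d3) (c4 + d4).
  by rewrite /cmb !scalerDl addrACA; congr (_ + _); rewrite addrACA.
have cmbZ a c1 c2 c3 c4 : a *: cmb c1 c2 c3 c4 = cmb (a * c1) (a * c2) (a * c3) (a * c4).
  by rewrite /cmb !scalerDr !scalerA.
have cmbM a b c d : (a *: x + b *: y) * (c *: x + d *: y) =
    cmb (a * c) (a * d) (b * c) (b * d).
  by rewrite /cmb !(mulrDl, mulrDr) -!(scalerAl, scalerAr) !scalerA.
have [xx xy] : x * x = cmb 1 0 0 0 /\ x * y = cmb 0 1 0 0.
  by rewrite /cmb !scale0r !scale1r !addr0 add0r.
have [yx yy] : y * x = cmb 0 0 1 0 /\ y * y = cmb 0 0 0 1.
  by rewrite /cmb !scale0r !scale1r !(addr0, add0r).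
rewrite /= !cmbM xx xy yx yy /detQ -!scaleN1r !(cmbZ, cmbD).
by congr cmb; ring.
Qed.

(** * The PBW module *)

Lemma mulmx_sum_scale (K : fieldType) (V : lmodType K) (A : 'M[K]_2) (w : 'cV[K]_2)
    (F : 'I_2 -> V) :
  \sum_i (A *m w) i 0 *: F i = \sum_i w i 0 *: (A 0 i *: F 0 + A 1 i *: F 1).
Proof.
rewrite !sum_ord2 !mxE !sum_ord2 !scalerDr !scalerDl !scalerA addrACA.
by rewrite ![A _ _ * _]mulrC.
Qed.

Section PBW.
Variables (K : fieldType) (gT : finGroupType).
Variable rho : mx_representation K [set: gT]%G 2.

Lemma rhoM g h : rho (g * h)%g = rho g *m rho h.
Proof. by rewrite repr_mxM ?inE. Qed.

(** These are the coefficients of v_0^2, v_1^2, v_0 v_1 and of the group elements that appear when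
    t_h is moved across the commutation relation. *)
Definition pbw_condition (q : K) (c : {ffun gT -> K}) : Prop :=
  [/\ forall h, (1 - q) * (rho h 0 0 * rho h 0 1) = 0,
      forall h, (1 - q) * (rho h 1 0 * rho h 1 1) = 0,
      forall h, (1 - q ^+ 2) * (rho h 0 1 * rho h 1 0) = 0
    & twisted (fun h => detQ q (rho h)) [set: gT] c].

(** Only the commutation relation for the pair (0, 1) is listed; those for the other pairs follow
    from it under [hecke_coherent]. *)
Record hecke_data (q : K) (c : gT -> K) (B : algType K)
    (v : 'I_2 -> B) (t : gT -> B) : Prop := HeckeData {
  data_one : t 1%g = 1;
  data_mul : forall g h, t g * t h = t (g * h)%g;
  data_act : forall g j, t g * v j = (\sum_i rho g i j *: v i) * t g;
  data_comm : v 1 * v 0 = q *: (v 0 * v 1) + \sum_g c g *: t g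
}.

(** Moving t_h to the right turns each v_j into h(v_j), and [qcomm_subst] expands the result. *)
Lemma act_qcomm q (B : algType K) (v : 'I_2 -> B) (t : gT -> B) h :
  (forall j, t h * v j = (\sum_i rho h i j *: v i) * t h) ->
  t h * (v 1 * v 0 - q *: (v 0 * v 1)) =
    (detQ q (rho h) *: (v 1 * v 0 - q *: (v 0 * v 1)) +
     (((1 - q) * (rho h 0 0 * rho h 0 1)) *: (v 0 * v 0) +
     ((1 - q ^+ 2) * (rho h 0 1 * rho h 1 0)) *: (v 0 * v 1) +
     ((1 - q) * (rho h 1 0 * rho h 1 1)) *: (v 1 * v 1))) * t h.
Proof.
move=> act; rewrite -qcomm_subst /=.
have tv j : t h * v j = (rho h 0 j *: v 0 + rho h 1 j *: v 1) * t h.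
  by rewrite act sum_ord2.
rewrite mulrBr -scalerAr !mulrA !tv -!mulrA !tv !mulrA.
by rewrite mulrBl scalerAl.
Qed.

Local Notation key := (nat * nat * gT)%type.
Local Notation M := {malg K[key]}.
Implicit Types (k : key) (x y : M).

Definition kmul h k : key := (k.1, (k.2 * h)%g).
(** Right multiplication by t_h, where the key (a, b, g) stands for v_0^a v_1^b t_g. *)
Definition rgrp h : M -> M := ext (fun k => bas K (kmul h k)).
HB.instance Definition _ h := GRing.Linear.on (rgrp h).

Lemma rgrp_bas h k : rgrp h (bas K k) = bas K (kmul h k).
Proof. exact: ext_bas. Qed.

Lemma rgrpM g h x : rgrp h (rgrp g x) = rgrp (g * h) x.
Proof.
apply: (malg_linear_ext (f := rgrp h \o rgrp g)) => k /=.
by rewrite !rgrp_bas /kmul /= mulgA.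
Qed.

Lemma rgrp1 x : rgrp 1 x = x.
Proof.
apply: (malg_linear_ext (f := rgrp 1) (g := idfun)) => -[m g] /=.
by rewrite rgrp_bas /kmul /= mulg1.
Qed.

(* The coordinates of v_0^a v_1^b v_i, when R a b are those of v_0^a v_1^b v_0. *)
Definition rgen (R : nat -> nat -> M) (i : 'I_2) (a b : nat) : M :=
  if i == 0 then R a b else bas K (a, b.+1, 1%g).

(* Right multiplication by the vector w: (m t_g) w = (m g(w)) t_g. *)
Definition rvec R (w : 'cV[K]_2) : M -> M :=
  ext (fun k => rgrp k.2 (\sum_i (rho k.2 *m w) i 0 *: rgen R i k.1.1 k.1.2)).
HB.instance Definition _ R w := GRing.Linear.on (rvec R w).

Lemma rvec_bas R w k : rvec R w (bas K k) =
  rgrp k.2 (\sum_i (rho k.2 *m w) i 0 *: rgen R i k.1.1 k.1.2).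
Proof. exact: ext_bas. Qed.

(** This is m t_h w = m h(w) t_h; it holds for any table [R] because [rho] is multiplicative. *)
Lemma rvec_rgrp R w h x : rvec R w (rgrp h x) = rgrp h (rvec R (rho h *m w) x).
Proof.
apply: (malg_linear_ext (f := rvec R w \o rgrp h)
  (g := rgrp h \o rvec R (rho h *m w))) => k /=.
by rewrite rgrp_bas !rvec_bas rgrpM /= rhoM mulmxA.
Qed.

Local Notation e j := (delta_mx j 0 : 'cV[K]_2).

Lemma rvec_delta_bas R j (k : key) : rvec R (e j) (bas K k) =
  rgrp k.2 (rho k.2 0 j *: R k.1.1 k.1.2 + rho k.2 1 j *: bas K (k.1.1, k.1.2.+1, 1%g)).
Proof. by rewrite rvec_bas sum_ord2 -colE !mxE. Qed.

Variables (q : K) (c : {ffun gT -> K}).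
Implicit Types R : nat -> nat -> M.

(* The coordinates of v_0^a v_1^b v_0, computed with fuel n > a + b from
   v_0^a v_1^(b+1) v_0 = q v_0^a v_1^b v_0 v_1 + v_0^a v_1^b kappa. *)
Fixpoint tab (n a b : nat) : M :=
  match n, b with
  | 0, _ => 0
  | n.+1, 0 => bas K (a.+1, 0%N, 1%g)
  | n.+1, b.+1 => q *: rvec (tab n) (e 1) (tab n a b) + \sum_g c g *: bas K (a, b, g)
  end.

Lemma tabS n a b : tab n.+1 a b.+1 =
  q *: rvec (tab n) (e 1) (tab n a b) + \sum_g c g *: bas K (a, b, g).
Proof. by []. Qed.

(* The leading terms of tab n a b have trivial group part, so multiplying them by
   v_1 needs no further entry of the table. *)
Definition low (d : nat) k : Prop :=
  (k.1.1 + k.1.2 < d)%N \/ k.2 = 1%g /\ (k.1.1 + k.1.2 = d.+1)%N.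

Lemma low_lt d k : (k.1.1 + k.1.2 < d)%N -> low d k. Proof. by left. Qed.

(** Appending v_1 to a leading term keeps it leading. The other terms lie at least two degrees
    lower, and multiplying them by v_1 adds at most one degree, even if g(v_1) involves v_0 and the
    table is read again; so they stay below a + b + 1. *)
Lemma tab_low n a b : (a + b < n)%N -> lspan (low (a + b)) (@bas K _) (tab n a b).
Proof.
elim: n a b => // n IH a [|b] ltn /=.
  by apply: lspan_gen; right; rewrite /= !addn0.
rewrite addnS in ltn *; apply: lspanD; last first.
  apply: lspan_sum => g; apply/lspanZ/lspan_gen/low_lt => /=; lia.
apply: lspanZ; apply: lspan_sub (IH a b ltn) => -[[a' b'] g] lo.
rewrite -[X in lspan _ _ X]/(rvec (tab n) (e 1) (bas K (a', b', g))) rvec_delta_bas.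
rewrite linearD !linearZ /= rgrp_bas.
case: lo => /= [lt|[-> dE]]; last first.
  rewrite repr_mx1 !mxE /= scale0r add0r; apply/lspanZ/lspan_gen; right.
  by rewrite /= mul1g; split => //; lia.
apply: lspanD; apply: lspanZ; last by apply/lspan_gen/low_lt => /=; lia.
have lt' : (a' + b' < n)%N by lia.
apply: lspan_sub (IH a' b' lt') => -[[a1 b1] g1] lo.
rewrite -[X in lspan _ _ X]/(rgrp g _) rgrp_bas.
by apply/lspan_gen/low_lt; case: lo => /= [|[_]]; lia.
Qed.

(** On a leading term the group part is trivial, so the coefficient of v_0 in g(v_1) is 0 and the
    table is not read; on the other terms only entries of degree below d are read. *)
Lemma rvec_agree R R' d x : lspan (low d) (@bas K _) x ->
  (forall a b, (a + b < d)%N -> R a b = R' a b) -> rvec R (e 1) x = rvec R' (e 1) x.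
Proof.
move=> dx RR; apply: (lspan_eq _ dx) => -[[a b] g] /= lo.
rewrite !rvec_delta_bas /=.
case: lo => /= [lt|[-> _]]; first by rewrite RR.
by rewrite repr_mx1 !mxE /= !scale0r.
Qed.

Lemma tab_stable n m a b : (a + b < n)%N -> (a + b < m)%N -> tab n a b = tab m a b.
Proof.
elim: n m a b => [|n IH] m a b; first by rewrite ltn0.
case: m => [|m]; first by rewrite ltn0.
case: b => [|b] ltn ltm; first by [].
rewrite addnS in ltn ltm.
rewrite !tabS.
rewrite (IH m a b ltn ltm) (rvec_agree (R' := tab m) (tab_low ltm)) //; last first.
  move=> a' b' lt; apply: IH; lia.
Qed.

(** The fuel a + b + 1 is the least one that [tab_stable] covers. *)
Definition nf a b : M := tab (a + b).+1 a b.

Lemma nf_low a b : lspan (low (a + b)) (@bas K _) (nf a b).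
Proof. exact: tab_low. Qed.

Lemma nf0 a : nf a 0 = bas K (a.+1, 0%N, 1%g). Proof. by []. Qed.

(** The recursion survives the removal of the fuel because right multiplication of [nf a b] by v_1
    reads only entries of degree below a + b, where all sufficient fuels agree. *)
Lemma nfS a b :
  nf a b.+1 = q *: rvec nf (e 1) (nf a b) + \sum_g c g *: bas K (a, b, g).
Proof.
have <- : rvec (tab (a + b).+1) (e 1) (nf a b) = rvec nf (e 1) (nf a b).
  by apply: (rvec_agree (nf_low a b)) => a' b' lt; apply: tab_stable; lia.
by rewrite [LHS]/nf addnS.
Qed.

Lemma malg_nz : exists x : M, x != 0.
Proof.
exists (bas K (0%N, 0%N, 1%g)); apply/eqP => /malgP/(_ (0%N, 0%N, 1%g)) /eqP.
by rewrite mcoeff_bas eqxx mcoeff0 oner_eq0.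
Qed.

Local Notation E := (rend malg_nz).

(* The operators are opaque, since unfolding them makes unification diverge. *)
Fact rgrpE_subproof : {f : gT -> E | forall h, f h =1 rgrp h}.
Proof. by exists (fun h => Rend (linearP (rgrp h))). Qed.
Fact rvecE_subproof : {f : 'cV[K]_2 -> E | forall w, f w =1 rvec nf w}.
Proof. by exists (fun w => Rend (linearP (rvec nf w))). Qed.
Fact vgenE_subproof : {f : 'I_2 -> E | forall j, f j =1 rvec nf (e j)}.
Proof. by exists (fun j => Rend (linearP (rvec nf (e j)))). Qed.

Definition rgrpE : gT -> E := sval rgrpE_subproof.
Definition rvecE : 'cV[K]_2 -> E := sval rvecE_subproof.
Definition vgenE : 'I_2 -> E := sval vgenE_subproof.
Local Notation V j := (vgenE j).

Lemma rgrpEE h x : rgrpE h x = rgrp h x.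
Proof. exact: (svalP rgrpE_subproof). Qed.
Lemma rvecEE w x : rvecE w x = rvec nf w x.
Proof. exact: (svalP rvecE_subproof). Qed.
Lemma vgenEE j x : vgenE j x = rvec nf (e j) x.
Proof. exact: (svalP vgenE_subproof). Qed.

Lemma rend_malg_ext (f g : E) : (forall k, f (bas K k) = g (bas K k)) -> f = g.
Proof.
by move=> fg; apply: rendP; apply: (malg_linear_ext (f := f) (g := g)) => k; apply: fg.
Qed.

Lemma rvecE_sum w : rvecE w = \sum_i w i 0 *: V i.
Proof.
apply: rend_malg_ext => k.
rewrite rend_sumE rvecEE rvec_bas.
under [RHS]eq_bigr => i _ do rewrite rend_scaleE vgenEE rvec_delta_bas -linearZ.
rewrite -[RHS]linear_sum.
by rewrite (mulmx_sum_scale (rho k.2) w (fun i => rgen nf i k.1.1 k.1.2)).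
Qed.

Hypothesis Hc : pbw_condition q c.

(** On the vectors v_0^a v_1^b the commutation relation is the recursion for [nf]. Any other basis
    vector is such a vector times t_g, and moving t_g across the relation costs nothing under
    [pbw_condition]. *)
Lemma pbw_data : hecke_data q c (fun j => V j) rgrpE.
Proof.
have t1 : rgrpE 1%g = 1 by apply: rendP => x; rewrite rgrpEE rgrp1.
have tM g h : rgrpE g * rgrpE h = rgrpE (g * h)%g.
  by apply: rendP => x; rewrite rend_mulE !rgrpEE rgrpM.
have tA g j : rgrpE g * V j = (\sum_i rho g i j *: V i) * rgrpE g.
  have <- : rvecE (rho g *m e j) = \sum_i rho g i j *: V i.
    by rewrite rvecE_sum; apply: eq_bigr => i _; rewrite -colE mxE.
  by apply: rendP => x; rewrite !rend_mulE !rgrpEE vgenEE rvecEE rvec_rgrp.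
have [H1 H2 H3 twc] := Hc.
have comm0 a b : (V 1 * V 0 - q *: (V 0 * V 1)) (bas K (a, b, 1%g)) =
    \sum_g c g *: bas K (a, b, g).
  rewrite rend_addE rend_oppE rend_scaleE !rend_mulE !vgenEE !rvec_delta_bas.
  rewrite repr_mx1 !mxE /= !scale0r !scale1r addr0 add0r !rgrp1 rvec_delta_bas.
  rewrite repr_mx1 !mxE /= !scale0r !scale1r addr0 rgrp1 nfS.
  by rewrite addrAC subrr add0r.
split=> //; apply/eqP; rewrite addrC -subr_eq; apply/eqP.
apply: rend_malg_ext => -[[a b] g]; rewrite rend_sumE.
have -> : bas K (a, b, g) = rgrpE g (bas K (a, b, 1%g)).
  by rewrite rgrpEE rgrp_bas /kmul /= mul1g.
rewrite -rend_mulE act_qcomm // H1 H2 H3 !scale0r !addr0 rend_mulE rend_scaleE comm0.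
rewrite rgrpEE linearZ linear_sum /= scaler_sumr.
(* Since t_g t_(h^g) = t_h t_g, the term of h on the left matches that of h^g on the right. *)
rewrite [RHS](reindex_inj (conjg_inj g)) /=; apply: eq_bigr => h _.
rewrite linearZ /= rgrp_bas !rgrpEE !rgrp_bas scalerA.
have -> : c (h ^ g)%g = detQ q (rho g) * c h by rewrite conjgE mulgA twc ?inE.
by rewrite /kmul /= mul1g -conjgC.
Qed.

End PBW.

(** * Sufficiency of the PBW condition *)

Section Monomials.
Variables (K : fieldType) (gT : finGroupType).
Variable rho : mx_representation K [set: gT]%G 2.
Variables (q : K) (c : {ffun gT -> K}).
Local Notation key := (nat * nat * gT)%type.
Local Notation M := {malg K[key]}.
Local Notation e j := (delta_mx j 0 : 'cV[K]_2).
Local Notation nf := (nf rho q c).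
Local Notation rvec := (rvec rho).
Variables (B : algType K) (v : 'I_2 -> B) (t : gT -> B).

Definition pbw_mon (k : key) : B := v 0 ^+ k.1.1 * v 1 ^+ k.1.2 * t k.2.

Hypothesis D : hecke_data rho q c v t.
Local Notation Phi := (ext pbw_mon).

Lemma linear_mulr (V : lmodType K) (f : V -> B) y : linear f -> linear (fun x => f x * y).
Proof. by move=> fl a x z; rewrite fl mulrDl scalerAl. Qed.

Lemma ext_rgrp h x : Phi (rgrp h x) = Phi x * t h.
Proof.
apply: (malg_fun_ext (f := fun x => Phi (rgrp h x)) (g := fun x => Phi x * t h)) x => [||k].
- by move=> a x y; rewrite !linearP.
- by apply: linear_mulr; apply: linearP.
by rewrite rgrp_bas !ext_bas /pbw_mon /= -[RHS]mulrA (data_mul D).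
Qed.

(** A conditional form, for use inside the induction of [ext_nf]: the table is assumed correct only
    below degree d, and a key whose g(v_j) has no v_0 component never reads it. *)
Lemma ext_rvec d j x : lspan (fun k => (k.1.1 + k.1.2 < d)%N \/ rho k.2 0 j = 0) (@bas K _) x ->
  (forall a b, (a + b < d)%N -> Phi (nf a b) = v 0 ^+ a * v 1 ^+ b * v 0) ->
  Phi (rvec nf (e j) x) = Phi x * v j.
Proof.
move=> dx IH; apply: (lspan_fun_eq (f := fun x => Phi (rvec nf (e j) x))
  (g := fun x => Phi x * v j)) dx => [||[[a b] g] lt].
- by move=> a y z; rewrite !linearP.
- by apply: linear_mulr; apply: linearP.
rewrite rvec_delta_bas ext_rgrp linearD !linearZ /= !ext_bas /pbw_mon /=.
rewrite -[RHS]mulrA (data_act D) sum_ord2 !mulrDl !mulrDr (data_one D) mulr1.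
congr (_ + _); last by rewrite exprSr -!(scalerAl, scalerAr) !mulrA.
case: lt => /= [lt|->]; last by rewrite !scale0r !mul0r mulr0.
by rewrite IH // -!(scalerAl, scalerAr) !mulrA.
Qed.

(** By induction on a + b, the table computes v_0^a v_1^b v_0 correctly in every algebra satisfying
    the relations. *)
Lemma ext_nf a b : Phi (nf a b) = v 0 ^+ a * v 1 ^+ b * v 0.
Proof.
have [n] := ubnP (a + b); elim: n a b => // n IH a [|b] lt.
  by rewrite nf0 ext_bas /pbw_mon /= (data_one D) !expr0 !mulr1 exprSr.
rewrite nfS linearD linearZ /= (@ext_rvec (a + b)); last first.
- by move=> a' b' lt'; apply: IH; lia.
(* Terms of lower degree fall under the induction hypothesis; leading terms have g = 1, which fixes
   v_1. *)
- elim: (nf_low rho q c a b) => [k lo||x y _ Lx _ Ly|z x _ Lx].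
  + apply: lspan_gen; case: lo => [|[-> _]]; [by left|right].
    by rewrite repr_mx1 mxE.
  + exact: lspan0.
  + exact: lspanD.
  + exact: lspanZ.
rewrite IH; last by lia.
rewrite -mulrA exprSr -!mulrA (data_comm D) !mulrDr -!scalerAr; congr (_ + _).
rewrite linear_sum !mulr_sumr; apply: eq_bigr => g _.
by rewrite linearZ /= ext_bas /pbw_mon /= -!scalerAr mulrA.
Qed.

Lemma ext_rvecE j x : Phi (rvec nf (e j) x) = Phi x * v j.
Proof.
apply: (malg_fun_ext (f := fun x => Phi (rvec nf (e j) x)) (g := fun x => Phi x * v j)) x => [||k].
- by move=> a y z; rewrite !linearP.
- by apply: linear_mulr; apply: linearP.
apply: (@ext_rvec (k.1.1 + k.1.2).+1); last by move=> a b _; apply: ext_nf.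
by apply: lspan_gen; left.
Qed.

Definition hgen_map (i : hgen gT) : B := match i with inl j => v j | inr g => t g end.
Definition hecke_ev : free_alg K (hgen gT) -> B := free_lift hgen_map.

Lemma hecke_ev_morphism : alg_morphism hecke_ev.
Proof. exact: free_lift_morph. Qed.

Lemma hecke_ev_v j : hecke_ev (hv K gT j) = v j.
Proof. exact: free_lift_gen. Qed.

Lemma hecke_ev_t g : hecke_ev (ht K g) = t g.
Proof. exact: free_lift_gen. Qed.

(** The span of the monomials contains 1 and is stable under right multiplication by each generator,
    by [ext_rvecE] and [ext_rgrp]. *)
Lemma pbw_span x : exists y, hecke_ev x = Phi y.
Proof.
have [em] := (hecke_ev_morphism, tt).
suff: forall y, exists z, Phi y * hecke_ev x = Phi z.
  move=> /(_ (bas K (0%N, 0%N, 1%g))) [z]; rewrite ext_bas /pbw_mon /= (data_one D).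
  by rewrite !mulr1 mul1r; exists z.
elim/free_ind: x => [y|x x' IH IH' y|a x IH y|i x IH y].
- by exists y; rewrite (alg_morph1 em) mulr1.
- have [[z zE] [z' zE']] := (IH y, IH' y).
  by exists (z + z'); rewrite (alg_morphD em) mulrDr zE zE' linearD.
- have [z zE] := IH y.
  by exists (a *: z); rewrite (alg_morphZ em) -scalerAr zE linearZ.
- rewrite (alg_morphM em) mulrA {1}/hecke_ev free_lift_gen.
  case: i => [j|g] /=; first by rewrite -ext_rvecE; apply: IH.
  by rewrite -ext_rgrp; apply: IH.
Qed.

End Monomials.

Section FreeMonomials.
Variables (K : fieldType) (gT : finGroupType).
Variable rho : mx_representation K [set: gT]%G 2.
Variables (q : K) (c : {ffun gT -> K}).
Hypothesis Hc : pbw_condition rho q c.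
Local Notation V := (vgenE rho q c).
Local Notation t := (rgrpE K (gT:=gT)).


Lemma vgenE0_bas a : V 0 (bas K (a, 0%N, 1%g)) = bas K (a.+1, 0%N, 1%g).
Proof.
rewrite vgenEE rvec_delta_bas repr_mx1 !mxE /=.
by rewrite scale1r scale0r addr0 rgrp1 nf0.
Qed.

Lemma vgenE1_bas a b : V 1 (bas K (a, b, 1%g)) = bas K (a, b.+1, 1%g).
Proof.
rewrite vgenEE rvec_delta_bas repr_mx1 !mxE /=.
by rewrite scale1r scale0r add0r rgrp1.
Qed.

(** A linear relation among the monomials, applied to the vector of 1, becomes a relation among
    distinct basis vectors. Composition in [rend] is reversed, so the powers of v_0 act first. *)
Lemma pbw_mon_rend k : pbw_mon V t k (bas K (0%N, 0%N, 1%g)) = bas K k.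
Proof.
case: k => [[a b] g]; rewrite /pbw_mon !rend_mulE.
have -> : (V 0 ^+ a) (bas K (0%N, 0%N, 1%g)) = bas K (a, 0%N, 1%g).
  by elim: a => // a IH; rewrite exprSr rend_mulE IH vgenE0_bas.
have -> : (V 1 ^+ b) (bas K (a, 0%N, 1%g)) = bas K (a, b, 1%g).
  by elim: b => // b IH; rewrite exprSr rend_mulE IH vgenE1_bas.
by rewrite rgrpEE rgrp_bas /kmul /= mul1g.
Qed.

End FreeMonomials.

(** * The algebra presented by generators and relations *)

Section HeckePresentation.
Variables (K : fieldType) (gT : finGroupType).
Variable rho : mx_representation K [set: gT]%G 2.
Variables (Q : 'M[K]_2) (kappa : 'I_2 -> 'I_2 -> {ffun gT -> K}).
Local Notation q := (Q 0 1).
Local Notation c := (kappa 0 1).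
Local Notation key := (nat * nat * gT)%type.

(** This is what makes the relations for (0, 0), (1, 1) and (1, 0) consequences of the one for (0,
    1), which solved for v_0 v_1 reads v_0 v_1 = q^-1 v_1 v_0 - q^-1 kappa. *)
Definition hecke_coherent : Prop :=
  [/\ q != 0, forall i, Q i i = 1, Q 1 0 = q^-1,
      forall i g, kappa i i g = 0 & forall g, kappa 1 0 g = - q^-1 * c g].

Lemma hecke_ev_hgrp (B : algType K) (v : 'I_2 -> B) t (k : {ffun gT -> K}) :
  hecke_ev v t (hgrp k) = \sum_g k g *: t g.
Proof.
have em := hecke_ev_morphism v t.
rewrite (alg_morphism_sum em); apply: eq_bigr => g _.
by rewrite (alg_morphZ em) hecke_ev_t.
Qed.

Lemma hecke_ev_hvec (B : algType K) (v : 'I_2 -> B) (t : gT -> B) w :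
  hecke_ev v t (hvec gT w) = \sum_i w i 0 *: v i.
Proof.
have em := hecke_ev_morphism v t.
rewrite (alg_morphism_sum em); apply: eq_bigr => i _.
by rewrite (alg_morphZ em) hecke_ev_v.
Qed.

Section Evaluation.
Variables (B : algType K) (v : 'I_2 -> B) (t : gT -> B).
Hypotheses (Hcoh : hecke_coherent) (D : hecke_data rho q c v t).

Lemma hecke_ev_rel x : hrel rho Q kappa x -> hecke_ev v t x = 0.
Proof.
have em := hecke_ev_morphism v t; have [q0 Qii Q10 kii k10] := Hcoh.
case=> [|g h|g w|i j]; rewrite (alg_morphB em).
- by rewrite hecke_ev_t (data_one D) (alg_morph1 em) subrr.
- by rewrite (alg_morphM em) !hecke_ev_t (data_mul D) subrr.
- rewrite !(alg_morphM em) !hecke_ev_hvec hecke_ev_t; apply/eqP; rewrite subr_eq0; apply/eqP.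
  rewrite mulr_sumr; under eq_bigr => i _ do rewrite -scalerAr (data_act D) scalerAl.
  rewrite -mulr_suml; congr (_ * _); rewrite mulmx_sum_scale.
  by apply: eq_bigr => i _; rewrite sum_ord2.
- rewrite (alg_morphD em) (alg_morphZ em) !(alg_morphM em) !hecke_ev_v hecke_ev_hgrp.
  have kii0 k : \sum_g kappa k k g *: t g = 0.
    by rewrite big1 // => g _; rewrite kii scale0r.
  move: i j; apply: ord2P; apply: ord2P.
  + by rewrite Qii scale1r kii0 addr0 subrr.
  + by rewrite (data_comm D) subrr.
  + have -> : \sum_g kappa 1 0 g *: t g = - (q^-1 *: \sum_g c g *: t g).
      rewrite scaler_sumr -sumrN; apply: eq_bigr => g _.
      by rewrite k10 mulNr scaleNr scalerA.
    by rewrite Q10 (data_comm D) scalerDr scalerA mulVf // scale1r addrK subrr.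
  + by rewrite Qii scale1r kii0 addr0 subrr.
Qed.

End Evaluation.

Lemma hecke_alg_data (nz : (1 : hecke_alg rho Q kappa) != 0) :
  hecke_data rho q c (fun i => nz_pi nz (hv K gT i)) (fun g => nz_pi nz (ht K g)).
Proof.
have pm := nz_pi_morphism nz; have rel x := @nz_pi_rel _ _ _ nz x.
have relB x y : hrel rho Q kappa (x - y) -> nz_pi nz x = nz_pi nz y.
  by move=> /rel /eqP; rewrite (alg_morphB pm) subr_eq0 => /eqP.
split=> [|g h|g j|].
- by rewrite -(alg_morph1 pm); apply: relB; constructor.
- by rewrite -(alg_morphM pm); apply: relB; constructor.
- have := relB _ _ (HrelAct rho Q kappa g (delta_mx j 0)).
  have hvecE (w : 'cV[K]_2) : nz_pi nz (hvec gT w) = \sum_i w i 0 *: nz_pi nz (hv K gT i).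
    by rewrite (alg_morphism_sum pm); apply: eq_bigr => i _; rewrite (alg_morphZ pm).
  rewrite !(alg_morphM pm) !hvecE (bigD1 j) //= big1 => [|i /negPf ij].
    rewrite mxE !eqxx scale1r addr0 => ->; congr (_ * _).
    by apply: eq_bigr => i _; rewrite -colE mxE.
  by rewrite mxE ij scale0r.
- have := relB _ _ (HrelComm rho Q kappa 0 1).
  rewrite (alg_morphD pm) (alg_morphZ pm) !(alg_morphM pm) => ->; congr (_ + _).
  by rewrite (alg_morphism_sum pm); apply: eq_bigr => i _; rewrite (alg_morphZ pm).
Qed.

Lemma hecke_pi_mon (nz : (1 : hecke_alg rho Q kappa) != 0) (m : key) :
  hecke_pi rho Q kappa (hv K gT 0 ^+ m.1.1 * hv K gT 1 ^+ m.1.2 * ht K m.2) =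
  pbw_mon (fun i => nz_pi nz (hv K gT i)) (fun g => nz_pi nz (ht K g)) m.
Proof.
have pm := nz_pi_morphism nz.
by rewrite -[LHS]/(nz_pi nz _) !(alg_morphM pm) !(alg_morphX pm).
Qed.

Lemma hecke_ev_pi (nz : (1 : hecke_alg rho Q kappa) != 0) x :
  hecke_ev (fun i => nz_pi nz (hv K gT i)) (fun g => nz_pi nz (ht K g)) x = nz_pi nz x.
Proof.
apply: (free_morph_ext (hecke_ev_morphism _ _) (nz_pi_morphism nz)) x => -[i|g].
  exact: hecke_ev_v.
exact: hecke_ev_t.
Qed.

Lemma pbw_is_qdh : hecke_coherent -> pbw_condition rho q c -> is_qdh rho Q kappa.
Proof.
move=> Hcoh Hc; have Dr := pbw_data Hc.
have em := hecke_ev_morphism (vgenE rho q c) (@rgrpE K gT).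
(* The operators on the PBW module satisfy the relations and live in a nonzero algebra. *)
have nz := quot_one_neq0 em (hecke_ev_rel Hcoh Dr).
have D := hecke_alg_data nz; split.
  have [q0 Qii Q10 _ _] := Hcoh.
  by apply: ord2P; apply: ord2P; rewrite ?Qii ?oner_neq0 ?Q10 ?invr_neq0.
apply/is_basisP; split=> [x x0|].
  pose L : nz_quot nz -> rend _ := nz_lift (hecke_ev (vgenE rho q c) (@rgrpE K gT)).
  have Lm : alg_morphism L := nz_lift_morphism nz em (hecke_ev_rel Hcoh Dr).
  pose b (m : key) : nz_quot nz := nz_pi nz (hv K gT 0 ^+ m.1.1 * hv K gT 1 ^+ m.1.2 * ht K m.2).
  (* [b] is the same family, seen in the copy [nz_quot]. *)
  have xb0 : ext b x = 0 by [].
  (* Letting the image of x act on the vector of 1 gives x back. *)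
  suff LE : (fun y => L (ext b y) (bas K (0%N, 0%N, 1%g))) =1 id.
    by rewrite -[x]LE xb0 (alg_morph0 Lm).
  apply: malg_fun_ext => [a y z||m] //; first by rewrite linearP Lm.1.
  rewrite ext_bas /b /L nz_lift_pi //; last exact: hecke_ev_rel.
  by rewrite !(alg_morphM em) !(alg_morphX em) !hecke_ev_v hecke_ev_t -[RHS](pbw_mon_rend rho q c).
elim/quot_ind=> x.
have [y yE] := pbw_span D x; exists y.
rewrite -[LHS]/(nz_pi nz x) -hecke_ev_pi yE !extE; apply: eq_bigr => m _.
by rewrite -hecke_pi_mon.
Qed.

End HeckePresentation.

(** * Necessity of the PBW condition *)

Section IndependentMonomials.
Variables (K : fieldType) (gT : finGroupType) (rho : mx_representation K [set: gT]%G 2).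
Variables (B : algType K) (v : 'I_2 -> B) (t : gT -> B).
Local Notation key := (nat * nat * gT)%type.
Hypothesis inj : forall x, ext (pbw_mon v t) x = 0 -> x = 0.

(** The left side is a combination of the distinct monomials v_0^2 t_h, v_0 v_1 t_h, v_1^2 t_h and
    t_g, so each coefficient is 0. *)
Lemma pbw_quad_eq0 h (a b d : K) (k : gT -> K) :
  (a *: (v 0 * v 0) + b *: (v 0 * v 1) + d *: (v 1 * v 1)) * t h +
    \sum_g k g *: t g = 0 ->
  [/\ a = 0, b = 0, d = 0 & forall g, k g = 0].
Proof.
move=> E; pose x : {malg K[key]} := a *: bas K (2%N, 0%N, h) + b *: bas K (1%N, 1%N, h) +
  d *: bas K (0%N, 2%N, h) + \sum_g k g *: bas K (0%N, 0%N, g).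
have x0 : x = 0.
  apply: inj; rewrite /x !linearD !linearZ linear_sum /= !ext_bas /pbw_mon /=.
  rewrite !expr0 !mulr1 !mul1r -[RHS]E !mulrDl !scalerAl; congr (_ + _).
  by apply: eq_bigr => g _; rewrite linearZ /= ext_bas /pbw_mon /= !expr0 !mul1r.
have coefE m : a * ((2%N, 0%N, h) == m)%:R + b * ((1%N, 1%N, h) == m)%:R +
    d * ((0%N, 2%N, h) == m)%:R + \sum_g' k g' * ((0%N, 0%N, g') == m)%:R = 0.
  have := congr1 (mcoeff m) x0; rewrite mcoeff0 !mcoeffD !mcoeffZ !mcoeff_bas raddf_sum.
  by under eq_bigr => g' _ do rewrite /= mcoeffZ mcoeff_bas.
have sum0 i j g : (0 < i + j)%N -> \sum_g' k g' * ((0%N, 0%N, g') == (i, j, g))%:R = 0.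
  move=> ij; apply: big1 => g' _; rewrite !xpair_eqE.
  by case: i j ij => [|i] [|j] //= _; rewrite ?andbF mulr0.
split=> [|||g].
- by move: (coefE (2%N, 0%N, h)); rewrite sum0 // !xpair_eqE /= !mulr0 eqxx mulr1 !addr0.
- by move: (coefE (1%N, 1%N, h)); rewrite sum0 // !xpair_eqE /= !mulr0 eqxx mulr1 !addr0 add0r.
- by move: (coefE (0%N, 2%N, h)); rewrite sum0 // !xpair_eqE /= !mulr0 eqxx mulr1 !addr0 !add0r.
- move: (coefE (0%N, 0%N, g)); rewrite !xpair_eqE /= !mulr0 !add0r.
  rewrite (bigD1 g) //= eqxx mulr1 big1 ?addr0 // => g' /negPf g'g.
  by rewrite xpair_eqE g'g mulr0.
Qed.

Variables (Q : 'M[K]_2) (kappa : 'I_2 -> 'I_2 -> {ffun gT -> K}).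
Local Notation q := (Q 0 1).
Local Notation c := (kappa 0 1).
Hypothesis Q0 : forall i j, Q i j != 0.
Hypothesis D : hecke_data rho q c v t.
Hypothesis comm :
  forall i j, v j * v i = Q i j *: (v i * v j) + \sum_g kappa i j g *: t g.

Lemma independent_coherent : hecke_coherent Q kappa.
Proof.
have t1 := data_one D.
(* The factor t_1 = 1 gives the relation for (i, i) the shape required by [pbw_quad_eq0]. *)
have ii i : v i * v i = Q i i *: (v i * v i) + \sum_g kappa i i g *: t g ->
    (1 - Q i i) *: (v i * v i) * t 1%g + \sum_g - kappa i i g *: t g = 0.
  move=> E; under eq_bigr => g _ do rewrite scaleNr.
  by rewrite t1 mulr1 scalerBl scale1r sumrN {1}E addrAC addrK subrr.
have Qkii i : Q i i = 1 /\ forall g, kappa i i g = 0.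
  suff [H1 H2] : 1 - Q i i = 0 /\ forall g, - kappa i i g = 0.
    split; first by apply/eqP; rewrite eq_sym -subr_eq0 H1.
    by move=> g; rewrite -[LHS]opprK H2 oppr0.
  move: i; apply: ord2P.
    have := @pbw_quad_eq0 1%g (1 - Q 0 0) 0 0 (fun g => - kappa 0 0 g).
    by rewrite !scale0r !addr0 => /(_ (ii 0 (comm 0 0))) [].
  have := @pbw_quad_eq0 1%g 0 0 (1 - Q 1 1) (fun g => - kappa 1 1 g).
  by rewrite !scale0r !add0r => /(_ (ii 1 (comm 1 1))) [].
(* The relation for (0, 1) is substituted into v_0 v_1 = Q_10 v_1 v_0 + kappa_10. *)
have [|_ H1 _ H2] := @pbw_quad_eq0 1%g 0 (Q 1 0 * q - 1) 0 (fun g => Q 1 0 * c g + kappa 1 0 g).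
  rewrite !scale0r addr0 add0r t1 mulr1 scalerBl scale1r.
  under eq_bigr => g _ do rewrite scalerDl -scalerA.
  rewrite big_split -scaler_sumr /=.
  rewrite addrACA -scalerA -scalerDr -comm [X in _ + X]addrC.
  by rewrite addrA -comm subrr.
have Q10 : Q 1 0 = q^-1.
  by apply: (mulIf (Q0 0 1)); rewrite mulVf //; apply/eqP; rewrite -subr_eq0 H1.
split=> [|i||i g|g]; rewrite ?Q0 //; try by case: (Qkii i).
by apply/eqP; rewrite mulNr -Q10 -addr_eq0 addrC H2.
Qed.

(** The product of t_h with kappa is computed in two ways, directly and by [act_qcomm], and the
    normal forms are compared. *)
Lemma independent_condition : pbw_condition rho q c.
Proof.
have H h : [/\ (1 - q) * (rho h 0 0 * rho h 0 1) = 0,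
    (1 - q ^+ 2) * (rho h 0 1 * rho h 1 0) = 0,
    (1 - q) * (rho h 1 0 * rho h 1 1) = 0
  & forall g, detQ q (rho h) * c (g * h^-1)%g - c (h^-1 * g)%g = 0].
  apply: (@pbw_quad_eq0 h).
  have := act_qcomm q (fun j => data_act D h j).
  rewrite (data_comm D) addrAC subrr add0r mulrDl => E.
  have -> : \sum_g (detQ q (rho h) * c (g * h^-1)%g - c (h^-1 * g)%g) *: t g =
      detQ q (rho h) *: (\sum_g c g *: t g) * t h - t h * \sum_g c g *: t g.
    under eq_bigr => g _ do rewrite scalerBl.
    rewrite sumrB; congr (_ - _).
      rewrite -scalerAl mulr_suml scaler_sumr (reindex_inj (mulIg h)) /=.
      by apply: eq_bigr => g _; rewrite mulgK -scalerAl (data_mul D) scalerA.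
    rewrite mulr_sumr (reindex_inj (mulgI h)) /=; apply: eq_bigr => g _.
    by rewrite mulKg -scalerAr (data_mul D).
  by rewrite E opprD addNKr subrr.
split=> [h|h|h|g h _]; try by case: (H h).
(* At the element g h the two arguments of c become g and h^-1 g h. *)
have [_ _ _] := H h; move/(_ (g * h)%g)/eqP.
by rewrite mulgK mulgA subr_eq0 eq_sym => /eqP.
Qed.

End IndependentMonomials.

Section Necessity.
Variables (K : fieldType) (gT : finGroupType).
Variable rho : mx_representation K [set: gT]%G 2.
Variables (Q : 'M[K]_2) (kappa : 'I_2 -> 'I_2 -> {ffun gT -> K}).
Local Notation q := (Q 0 1).
Local Notation c := (kappa 0 1).
Local Notation key := (nat * nat * gT)%type.

Hypothesis qdh : is_qdh rho Q kappa.

(** In the zero ring the monomial indexed by (0, 0, 1) would vanish, against independence. *)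
Lemma qdh_nz : (1 : hecke_alg rho Q kappa) != 0.
Proof.
have [_ /is_basisP[inj _]] := qdh; apply/eqP => e10.
have b0 : bas K ((0%N, 0%N, 1%g) : key) = 0.
  by apply: inj; rewrite ext_bas -[LHS]mulr1 e10 mulr0.
have /eqP := congr1 (mcoeff (0%N, 0%N, 1%g)) b0.
by rewrite mcoeff_bas eqxx mcoeff0 oner_eq0.
Qed.

Local Notation v := (fun i => nz_pi qdh_nz (hv K gT i)).
Local Notation t := (fun g => nz_pi qdh_nz (ht K g)).

Lemma qdh_inj x : ext (pbw_mon v t) x = 0 -> x = 0.
Proof.
have [_ /is_basisP[inj _]] := qdh => x0; apply: inj; rewrite -[RHS]x0 !extE.
by apply: eq_bigr => m _; rewrite -hecke_pi_mon.
Qed.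

Lemma qdh_comm i j : v j * v i = Q i j *: (v i * v j) + \sum_g kappa i j g *: t g.
Proof.
have pm := nz_pi_morphism qdh_nz.
have /eqP := nz_pi_rel qdh_nz (HrelComm rho Q kappa i j).
rewrite (alg_morphB pm) subr_eq0 => /eqP.
rewrite (alg_morphD pm) (alg_morphZ pm) !(alg_morphM pm) => ->; congr (_ + _).
by rewrite (alg_morphism_sum pm); apply: eq_bigr => g _; rewrite (alg_morphZ pm).
Qed.

Lemma qdh_coherent : hecke_coherent Q kappa.
Proof.
have [Q0 _] := qdh.
exact: (independent_coherent qdh_inj Q0 (hecke_alg_data qdh_nz) qdh_comm).
Qed.

Lemma qdh_condition : pbw_condition rho q c.
Proof. exact: (independent_condition qdh_inj (hecke_alg_data qdh_nz)). Qed.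

End Necessity.

(** * The universal property *)

Section Universal.
Variables (K : fieldType) (gT : finGroupType).
Variable rho : mx_representation K [set: gT]%G 2.

(** B is initial among the algebras equipped with [hecke_data]. *)
Record hecke_universal (q : K) (c : gT -> K) (B : algType K)
    (v : 'I_2 -> B) (t : gT -> B) : Prop := HeckeUniversal {
  universal_data : hecke_data rho q c v t;
  universal_ex : forall (B' : algType K) v' t', hecke_data rho q c v' t' ->
    exists f : B -> B', [/\ alg_morphism f, forall i, f (v i) = v' i
                          & forall g, f (t g) = t' g];
  universal_uniq : forall (B' : algType K) (f f' : B -> B'),
    alg_morphism f -> alg_morphism f' -> (forall i, f (v i) = f' (v i)) ->
    (forall g, f (t g) = f' (t g)) -> f =1 f'
}.

Lemma universal_iso q c (B B' : algType K) v t v' t' :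
  @hecke_universal q c B v t -> @hecke_universal q c B' v' t' ->
  exists f : B -> B', [/\ alg_iso f, forall i, f (v i) = v' i & forall g, f (t g) = t' g].
Proof.
move=> U U'; have [f [fm fv ft]] := universal_ex U (universal_data U').
have [f' [fm' fv' ft']] := universal_ex U' (universal_data U).
exists f; split=> //; split=> //; exists f' => x.
  apply: (universal_uniq U (alg_morphism_comp fm fm') (alg_morphism_id B)) => [i|g] /=.
    by rewrite fv fv'.
  by rewrite ft ft'.
apply: (universal_uniq U' (alg_morphism_comp fm' fm) (alg_morphism_id B')) => [i|g] /=.
  by rewrite fv' fv.
by rewrite ft' ft.
Qed.

Lemma hecke_alg_universal Q kappa (nz : (1 : hecke_alg rho Q kappa) != 0) :
  hecke_coherent Q kappa ->
  hecke_universal (Q 0 1) (kappa 0 1)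
    (fun i => nz_pi nz (hv K gT i)) (fun g => nz_pi nz (ht K g)).
Proof.
move=> Hcoh; split=> [|B v t D|B f f' fm fm' fv ft].
- exact: hecke_alg_data.
- have em := hecke_ev_morphism v t; have er := hecke_ev_rel Hcoh D.
  exists (nz_lift (hecke_ev v t)); split=> [|i|g]; first exact: nz_lift_morphism.
    by rewrite nz_lift_pi // hecke_ev_v.
  by rewrite nz_lift_pi // hecke_ev_t.
- elim/quot_ind=> x; have pm := nz_pi_morphism nz.
  apply: (free_morph_ext (alg_morphism_comp pm fm) (alg_morphism_comp pm fm')) x.
  by case=> [i|g]; [apply: fv|apply: ft].
Qed.

Section SkewEvaluation.
Variables (q : K) (c : gT -> K) (B : algType K) (v : 'I_2 -> B) (t : gT -> B).
Hypothesis D : hecke_data rho q c v t.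
Local Notation L := (free_lift v).
Local Notation pure := (skew_pure (free_action rho)).

(** The relation t_g v_j = g(v_j) t_g extends from letters to words, t_g being passed across one
    letter at a time. *)
Lemma free_lift_act g a : t g * L a = L (free_act rho g a) * t g.
Proof.
have Lm := free_lift_morph v; have am := free_act_morph rho g.
elim/free_ind: a => [|a b IHa IHb|k a IH|i a IH].
- by rewrite (alg_morph1 am) (alg_morph1 Lm) mul1r mulr1.
- by rewrite (alg_morphD am) !(alg_morphD Lm) mulrDr mulrDl IHa IHb.
- by rewrite (alg_morphZ am) !(alg_morphZ Lm) -scalerAr -scalerAl IH.
- rewrite (alg_morphM am) !(alg_morphM Lm) mulrA free_lift_gen (data_act D).
  rewrite -[LHS]mulrA IH mulrA; congr (_ * _ * _).
  rewrite /free_act free_lift_gen (alg_morphism_sum Lm); apply: eq_bigr => j _.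
  by rewrite (alg_morphZ Lm) free_lift_gen.
Qed.

Definition skew_ev : skew_free rho -> B := skew_lift L t.

Lemma skew_ev_morphism : alg_morphism skew_ev.
Proof.
apply: skew_lift_morphism (free_lift_morph v) (data_one D) (data_mul D) _.
exact: free_lift_act.
Qed.

Lemma skew_ev_pure a g : skew_ev (pure a g) = L a * t g.
Proof. exact: skew_lift_pure (free_lift_morph v) a g. Qed.

Lemma free_lift_qcomm : L (qcomm q) = v 1 * v 0 - q *: (v 0 * v 1).
Proof.
have Lm := free_lift_morph v.
by rewrite (alg_morphB Lm) (alg_morphZ Lm) !(alg_morphM Lm) !free_lift_gen.
Qed.

Lemma skew_ev_rel x : skew_rel q (\sum_g c g *: pure 1 g) x -> skew_ev x = 0.
Proof.
have em := skew_ev_morphism; have Lm := free_lift_morph v.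
move=> ->; rewrite (alg_morphB em) skew_ev_pure free_lift_qcomm (alg_morphism_sum em).
have -> : v 1 * v 0 - q *: (v 0 * v 1) = \sum_g c g *: t g.
  by rewrite (data_comm D) addrAC subrr add0r.
rewrite (data_one D) mulr1; apply/eqP; rewrite subr_eq0; apply/eqP/eq_bigr => g _.
by rewrite (alg_morphZ em) skew_ev_pure (alg_morph1 Lm) mul1r.
Qed.

End SkewEvaluation.

Section SkewQuot.
Variables (q : K) (c : gT -> K).
Local Notation pure := (skew_pure (free_action rho)).
Local Notation w := (\sum_g c g *: pure 1 g).

(** The skew group algebra of the free algebra already encodes the group relations and the action on
    V; the quotient adds the commutation relation. *)
Lemma skew_quot_universal (nz : (1 : skew_quot q w) != 0) :
  hecke_universal q c (fun i => nz_pi nz (pure (fv K i) 1%g)) (fun g => nz_pi nz (pure 1 g)).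
Proof.
have pm := nz_pi_morphism nz; have sm := skew_pure_morphism (free_action rho).
split=> [|B v t D|B f f' fm fm' fv ft].
- split=> [|g h|g j|]; rewrite -?(alg_morphM pm).
  + exact: (alg_morph1 pm).
  + by rewrite skew_pureM (alg_morph1 (Defs.act_morph (free_action rho) g)) mulr1.
  + have -> : \sum_i rho g i j *: nz_pi nz (pure (fv K i) 1%g) =
        nz_pi nz (pure (\sum_i rho g i j *: fv K i) 1%g).
      have smp := alg_morphism_comp sm pm.
      rewrite -[RHS]/((nz_pi nz \o pure^~ 1%g) _) (alg_morphism_sum smp).
      by apply: eq_bigr => i _; rewrite (alg_morphZ smp).
    by rewrite -!(alg_morphM pm) !skew_pureM mul1r mulg1 mul1g act_id mulr1 /=
      /free_act free_lift_gen.
  + apply/eqP; rewrite -subr_eq0; apply/eqP.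
    have := nz_pi_rel nz (erefl : skew_rel q w (pure (qcomm q) 1%g - w)).
    rewrite /qcomm (alg_morphB sm) (alg_morphZ sm) !(alg_morphM sm) => E.
    rewrite -[RHS]E (alg_morphB pm) opprD addrA; congr (_ - _).
      by rewrite (alg_morphB pm) (alg_morphZ pm) !(alg_morphM pm).
    by rewrite (alg_morphism_sum pm); apply: eq_bigr => g _; rewrite (alg_morphZ pm).
- have em := skew_ev_morphism D; have er := skew_ev_rel D.
  exists (nz_lift (skew_ev v t)); split=> [|i|g]; first exact: nz_lift_morphism.
    by rewrite nz_lift_pi // skew_ev_pure free_lift_gen (data_one D) mulr1.
  by rewrite nz_lift_pi // skew_ev_pure (alg_morph1 (free_lift_morph v)) mul1r.
- elim/quot_ind=> x.
  apply: (skew_morph_ext (alg_morphism_comp pm fm) (alg_morphism_comp pm fm')) x => [a|g].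
    have smp := alg_morphism_comp sm pm.
    exact: (free_morph_ext (alg_morphism_comp smp fm) (alg_morphism_comp smp fm') fv).
  exact: ft.
Qed.

Lemma skew_quot_nz (B : algType K) (v : 'I_2 -> B) t :
  hecke_data rho q c v t -> (1 : skew_quot q w) != 0.
Proof. by move=> D; apply: quot_one_neq0 (skew_ev_morphism D) (skew_ev_rel D). Qed.

End SkewQuot.

Lemma hecke_skew_quot_iso Q kappa (nz : (1 : hecke_alg rho Q kappa) != 0) :
  hecke_coherent Q kappa ->
  hecke_skew_quot Q kappa (Q 0 1)
    (\sum_g kappa 0 1 g *: skew_pure (free_action rho) 1 g).
Proof.
move=> Hcoh; have nz' := skew_quot_nz (hecke_alg_data nz).
exact: universal_iso (hecke_alg_universal nz Hcoh) (skew_quot_universal nz').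
Qed.
End Universal.

(** * The case of zero kappa: the algebra S_Q(V)#G *)

Section Smash.
Variables (K : fieldType) (gT : finGroupType).
Variable rho : mx_representation K [set: gT]%G 2.
Variable q : K.
Local Notation sq := (sq_alg q).
Local Notation sqv := (sq_v q).

Definition sq_pi : free_alg K 'I_2 -> sq := quot_pi (sq_rel q).

Lemma sq_pi_morphism : alg_morphism sq_pi.
Proof. exact: quot_pi_alg_morphism. Qed.

Section SqLift.
Variables (B : algType K) (v : 'I_2 -> B).
Hypothesis vE : v 1 * v 0 = q *: (v 0 * v 1).

Lemma free_lift_sq_rel x : sq_rel q x -> free_lift v x = 0.
Proof. by move=> ->; rewrite free_lift_qcomm vE subrr. Qed.

(** [sq_alg q] and the [nz_quot] given by [sq_one_neq0] are the same quotient, so the lifting of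
    [nz_lift] applies. *)
Definition sq_lift : sq -> B := @nz_lift _ _ _ (sq_one_neq0 q) B (free_lift v).

Lemma sq_lift_morphism : alg_morphism sq_lift.
Proof.
exact: (nz_lift_morphism (sq_one_neq0 q) (free_lift_morph v) free_lift_sq_rel).
Qed.

Lemma sq_lift_pi x : sq_lift (sq_pi x) = free_lift v x.
Proof. exact: (nz_lift_pi (sq_one_neq0 q) (free_lift_morph v) free_lift_sq_rel). Qed.

Lemma sq_lift_v i : sq_lift (sqv i) = v i.
Proof. by rewrite sq_lift_pi free_lift_gen. Qed.

End SqLift.

Lemma sq_comm : sqv 1 * sqv 0 = q *: (sqv 0 * sqv 1).
Proof.
have pm := sq_pi_morphism; apply/eqP; rewrite -subr_eq0; apply/eqP.
have : sq_pi (qcomm q) = 0.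
  by rewrite -(alg_morph0 pm); apply/quot_piP; rewrite subr0 => I _; apply.
by rewrite /qcomm (alg_morphB pm) (alg_morphZ pm) !(alg_morphM pm).
Qed.

Lemma sq_morph_ext (B : algType K) (f f' : sq -> B) :
  alg_morphism f -> alg_morphism f' -> (forall i, f (sqv i) = f' (sqv i)) -> f =1 f'.
Proof.
move=> fm fm' ff' x; elim/quot_ind: x => x; have pm := sq_pi_morphism.
exact: (free_morph_ext (alg_morphism_comp pm fm) (alg_morphism_comp pm fm') ff').
Qed.

Section Action.
Variable c : {ffun gT -> K}.
Hypothesis Hc : pbw_condition rho q c.

Definition sq_image (g : gT) (j : 'I_2) : sq := \sum_i rho g i j *: sqv i.

(** The action on V descends to S_Q(V): the first three parts of [pbw_condition] remove the
    obstructions in [qcomm_subst]. *)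
Lemma sq_image_comm g : sq_image g 1 * sq_image g 0 = q *: (sq_image g 0 * sq_image g 1).
Proof.
have [H1 H2 H3 _] := Hc; apply/eqP; rewrite -subr_eq0 /sq_image !sum_ord2; apply/eqP.
by rewrite qcomm_subst H1 H2 H3 sq_comm subrr !scale0r !addr0 scaler0.
Qed.

Definition sq_act g : sq -> sq := sq_lift (sq_image g).

Lemma sq_act_morphism g : alg_morphism (sq_act g).
Proof. exact/sq_lift_morphism/sq_image_comm. Qed.

Lemma sq_act_v g j : sq_act g (sqv j) = sq_image g j.
Proof. exact/sq_lift_v/sq_image_comm. Qed.

Lemma sq_act_id x : sq_act 1%g x = x.
Proof.
apply: (sq_morph_ext (sq_act_morphism 1%g) (alg_morphism_id _)) x => j.
rewrite sq_act_v /sq_image repr_mx1 (bigD1 j) //= big1 => [|i /negPf ij].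
  by rewrite mxE eqxx scale1r addr0.
by rewrite mxE ij scale0r.
Qed.

Lemma sq_act_comp g h x : sq_act (g * h)%g x = sq_act g (sq_act h x).
Proof.
have gm := sq_act_morphism g; have hm := sq_act_morphism h.
apply: (sq_morph_ext (sq_act_morphism _) (alg_morphism_comp hm gm)) x => j /=.
rewrite !sq_act_v (alg_morphism_sum gm) /sq_image rhoM.
under [RHS]eq_bigr => k _ do rewrite (alg_morphZ gm) sq_act_v scaler_sumr.
rewrite exchange_big; apply: eq_bigr => i _ /=.
by rewrite mxE scaler_suml; apply: eq_bigr => k _; rewrite scalerA mulrC.
Qed.

Definition sq_action : alg_action gT sq :=
  AlgAction sq_act_morphism sq_act_id sq_act_comp.

Lemma sq_action_induced : induced_action rho sq_action.
Proof. exact: sq_act_v. Qed.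

End Action.

Section SmashUniversal.
Variable act : alg_action gT sq.
Hypothesis actE : induced_action rho act.
Local Notation pure := (skew_pure act).

Lemma smash_universal :
  hecke_universal rho q (fun=> 0) (fun i => pure (sqv i) 1%g) (fun g => pure 1 g).
Proof.
have sm := skew_pure_morphism act.
split=> [|B v t D|B f f' fm fm' fv ft].
- split=> [|g h|g j|] //.
  + by rewrite skew_pureM (alg_morph1 (Defs.act_morph act g)) mulr1.
  + have -> : \sum_i rho g i j *: pure (sqv i) 1%g = pure (\sum_i rho g i j *: sqv i) 1%g.
      rewrite (alg_morphism_sum sm).
      by apply: eq_bigr => i _; rewrite (alg_morphZ sm).
    by rewrite !skew_pureM mul1r mulg1 mul1g act_id mulr1 actE.
  + rewrite big1 ?addr0 => [|g _]; last by rewrite scale0r.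
    by rewrite -!(alg_morphM sm) sq_comm (alg_morphZ sm).
- have vE : v 1 * v 0 = q *: (v 0 * v 1).
    by rewrite (data_comm D) big1 ?addr0 // => g _; rewrite scale0r.
  have Lm := sq_lift_morphism vE.
  (* Covariance is known over the free algebra. It descends because the two actions agree on the
     generators. *)
  have tL g a : t g * sq_lift v a = sq_lift v (act g a) * t g.
    have am := Defs.act_morph act g.
    elim/quot_ind: a => a; rewrite -/(sq_pi a) sq_lift_pi // (free_lift_act D).
    congr (_ * _); rewrite -[LHS](sq_lift_pi vE); congr sq_lift.
    have pm := sq_pi_morphism; have fm := free_act_morph rho g.
    apply: (free_morph_ext (alg_morphism_comp fm pm) (alg_morphism_comp pm am)) a => j /=.
    rewrite [RHS]actE /free_act free_lift_gen (alg_morphism_sum pm).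
    by apply: eq_bigr => i _; rewrite (alg_morphZ pm).
  have fm := skew_lift_morphism Lm (data_one D) (data_mul D) tL.
  exists (skew_lift (sq_lift v) t); split=> [|i|g] //.
    by rewrite skew_lift_pure // sq_lift_v // (data_one D) mulr1.
  by rewrite skew_lift_pure // (alg_morph1 Lm) mul1r.
- move=> x; apply: (skew_morph_ext fm fm') x => [a|] //.
  exact: (sq_morph_ext (alg_morphism_comp sm fm) (alg_morphism_comp sm fm') fv).
Qed.

End SmashUniversal.
End Smash.

Lemma hecke_smash_iso (K : fieldType) (gT : finGroupType)
    (rho : mx_representation K [set: gT]%G 2) Q kappa
    (nz : (1 : hecke_alg rho Q kappa) != 0) :
  hecke_coherent Q kappa -> pbw_condition rho (Q 0 1) (kappa 0 1) ->
  (forall g, kappa 0 1 g = 0) -> hecke_smash rho Q kappa (Q 0 1).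
Proof.
move=> Hcoh Hc k0; exists (sq_action Hc); split; first exact: sq_action_induced.
have HU := hecke_alg_universal nz Hcoh.
have kE : (kappa 0 1 : gT -> K) = (fun=> 0) by apply/funext.
rewrite kE in HU.
exact: universal_iso HU (smash_universal (sq_action_induced Hc)).
Qed.

(** * Classification *)

(** The only candidate is c(x^h) = chi(h) d(x) for x in X. It is well defined: two choices of h
    differ by an element of the centralizer of x, on which chi is 1 unless d(x) = 0. *)
Lemma arbitrary_on_reps_character (K : fieldType) (gT : finGroupType) (chi : gT -> K)
    (D : {set gT}) :
  chi 1%g = 1 -> (forall g h, chi (g * h)%g = chi g * chi h) ->
  (forall g h, (g ^ h \in D)%g = (g \in D)) -> arbitrary_on_reps chi D.
Proof.
move=> chi1 chiM DJ X d /and3P[_ /subsetP XD /forallP tr] dX.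
have class_rep g : g \in D -> exists x h, x \in X /\ (g = x ^ h)%g.
  move=> gD; have /implyP/(_ (imset_f _ gD)) := tr (g ^: [set: gT])%g.
  case/cards1P=> x /setP/(_ x); rewrite !inE eqxx => /andP[xX /imsetP[h _ xE]].
  by exists x, (h^-1)%g; split; rewrite // xE -conjgM mulgV conjg1.
have rep_uniq x x' h h' : x \in X -> x' \in X -> (x ^ h = x' ^ h')%g -> x = x'.
  move=> xX xX' E; have /implyP/(_ (imset_f _ (XD _ xX))) := tr (x ^: [set: gT])%g.
  case/cards1P=> z /setP zE.
  have := zE x; rewrite !inE xX class_refl => /esym/eqP xz.
  have := zE x'; rewrite !inE xX' xz /= => zx'; apply/esym/eqP; rewrite -zx' -xz.
  apply/imsetP; exists (h * h'^-1)%g; rewrite ?inE //.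
  by rewrite conjgM E -conjgM mulgV conjg1.
(* A conjugator is picked arbitrarily; the value is 0 off the classes of X. *)
pose c : {ffun gT -> K} := [ffun g =>
  if [pick p : gT * gT | (p.1 \in X) && (g == p.1 ^ p.2)%g] is Some p
  then chi p.2 * d p.1 else 0].
have cX x h : x \in X -> c (x ^ h)%g = chi h * d x.
  move=> xX; rewrite ffunE; case: pickP => [[x' h'] /= /andP[xX' /eqP E]|/(_ (x, h))]; last first.
    by rewrite /= xX eqxx.
  have xx := rep_uniq _ _ _ _ xX xX' E; rewrite -xx in E *.
  have kC : (h' * h^-1 \in 'C[x])%g.
    by rewrite cent1C; apply/cent1P/commgP/conjg_fixP; rewrite conjgM -E -conjgM mulgV conjg1.
  case: (dX x xX) => [->|/(_ _ kC) k1]; first by rewrite !mulr0.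
  by rewrite -[h'](mulgKV h) chiM k1 mul1r.
exists c; split=> [g h gD|x xX|c' tw c'X g gD].
- have [x [k [xX ->]]] := class_rep g gD.
  by rewrite -mulgA -conjgE -conjgM !cX // chiM mulrA [chi k * _]mulrC.
- by rewrite -[x in c x]conjg1 cX // chi1 mul1r.
- have [x [k [xX ->]]] := class_rep g gD.
  by rewrite cX // conjgE mulgA tw ?XD // c'X.
Qed.

(** * The PBW condition in the three cases of q *)

Section Classification.
Variables (K : fieldType) (gT : finGroupType).
Variable rho : mx_representation K [set: gT]%G 2.

Lemma det2 (A : 'M[K]_2) : \det A = A 0 0 * A 1 1 - A 0 1 * A 1 0.
Proof.
rewrite (expand_det_row _ 0) sum_ord2 /cofactor !det_mx11 !mxE /= !expr0 !expr1.
rewrite mul1r mulN1r mulrN; congr (_ * A _ _ - _ * A _ _); exact: val_inj.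
Qed.

Lemma detQ1 (A : 'M[K]_2) : detQ 1 A = \det A.
Proof. by rewrite det2 /detQ mul1r. Qed.

Lemma rho_det g : \det (rho g) != 0.
Proof. by rewrite -unitfE; apply: (repr_mx_unit rho); rewrite inE. Qed.

Lemma rho_det2 g : rho g 0 0 * rho g 1 1 - rho g 0 1 * rho g 1 0 != 0.
Proof. by rewrite -det2 rho_det. Qed.

Definition coherent_mx (q : K) : 'M[K]_2 :=
  \matrix_(i, j) if i == j then 1 else if i == 0 then q else q^-1.

Definition coherent_kappa (q : K) (c : {ffun gT -> K}) (i j : 'I_2) : {ffun gT -> K} :=
  if i == j then 0 else if i == 0 then c else [ffun g => - q^-1 * c g].

Lemma coherent_coherent q c : q != 0 -> hecke_coherent (coherent_mx q) (coherent_kappa q c).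
Proof.
move=> q0; split=> [|i||i g|g]; rewrite ?mxE ?eqxx //.
- by rewrite /coherent_kappa eqxx ffunE.
- by rewrite /coherent_kappa /= ffunE.
Qed.

(** Coefficients outside [D] do not enter [skew_sum], whereas kappa is a function on all of G, so
    they are replaced by 0. *)
Definition restrict (D : {set gT}) (c : {ffun gT -> K}) : {ffun gT -> K} :=
  [ffun g => if g \in D then c g else 0].

Lemma skew_sum_restrict D c :
  skew_sum rho D c = \sum_g restrict D c g *: skew_pure (free_action rho) 1 g.
Proof.
rewrite /skew_sum big_mkcond; apply: eq_bigr => g _; rewrite ffunE.
by case: ifP; rewrite ?scale0r.
Qed.

(** Reduces the classification to solving [pbw_condition]; the universal property supplies the
    isomorphisms. *)
Lemma qdh_comprises_intro q D (P : {ffun gT -> K} -> Prop) : q != 0 ->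
  (forall c, P c -> pbw_condition rho q (restrict D c)) ->
  (forall c, pbw_condition rho q c -> P c /\ forall g, g \notin D -> c g = 0) ->
  qdh_comprises rho q D P.
Proof.
move=> q0 Psuf Pnec; split=> [Q kappa qE qdh|c Pc].
  subst q; have [Pc c0] := Pnec _ (qdh_condition qdh); exists (kappa 0 1) => //.
  suff -> : skew_sum rho D (kappa 0 1) =
      \sum_g kappa 0 1 g *: skew_pure (free_action rho) 1 g.
    exact: hecke_skew_quot_iso (qdh_nz qdh) (qdh_coherent qdh).
  rewrite skew_sum_restrict; apply: eq_bigr => g _; rewrite ffunE.
  by case: ifPn => // /c0 ->.
exists (coherent_mx q), (coherent_kappa q (restrict D c)).
have Hcoh := coherent_coherent (restrict D c) q0.
have qE : coherent_mx q 0 1 = q by rewrite mxE.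
have kE : coherent_kappa q (restrict D c) 0 1 = restrict D c by [].
have qdh : is_qdh rho (coherent_mx q) (coherent_kappa q (restrict D c)).
  by apply: pbw_is_qdh => //; rewrite qE kE; apply: Psuf.
split=> //; rewrite skew_sum_restrict -[q in hecke_skew_quot _ _ q]qE -kE.
exact: hecke_skew_quot_iso (qdh_nz qdh) Hcoh.
Qed.

(** When h commutes with g, the twisting relation reads c_g = chi(h) c_g. *)
Lemma twisted_centralizer (chi : gT -> K) D c g h : twisted chi D c -> g \in D ->
  h \in 'C[g]%g -> c g = 0 \/ chi h = 1.
Proof.
move=> tw gD /cent1P gh; have /eqP := tw g h gD.
have -> : (h^-1 * g * h)%g = g by rewrite -mulgA -gh mulKg.
rewrite -subr_eq0 -{1}[c g]mul1r -mulrBl mulf_eq0 subr_eq0 => /orP[/eqP <-|/eqP]; first by right.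
by left.
Qed.

Lemma rhoJ_det g h : \det (rho (h^-1 * g * h)%g) = \det (rho g).
Proof.
rewrite !rhoM !det_mulmx mulrAC -det_mulmx -rhoM mulVg repr_mx1 det1 mul1r //.
Qed.

Lemma comprises_commutative (D := [set g : gT | \det (rho g) == 1]) :
  qdh_comprises rho 1 D (twisted (fun h => \det (rho h)) D).
Proof.
apply: qdh_comprises_intro => [|c tw|c [_ _ _ tw]]; first exact: oner_neq0.
  split=> [h|h|h|g h _]; rewrite ?expr1n ?subrr ?mul0r //.
  rewrite !ffunE !inE rhoJ_det detQ1; case: ifP => [gD|]; last by rewrite mulr0.
  by rewrite tw ?inE.
split=> [g h gD|g]; first by rewrite tw ?inE // detQ1.
(* Since g centralizes itself, c_g = 0 unless det(g) = 1. *)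
rewrite inE => gD; case: (twisted_centralizer tw (in_setT g) (cent1id g)) => //.
by rewrite detQ1 => /eqP; rewrite (negPf gD).
Qed.

Section Diagonal.
Variables (q : K) (c : {ffun gT -> K}).
Hypotheses (q1 : q != 1) (qN1 : q != -1) (Hc : pbw_condition rho q c).

Lemma pbw_diagonal : acts_diagonally rho.
Proof.
have [H1 H2 H3 _] := Hc => g; have := rho_det2 g.
have nz1 : 1 - q != 0 by rewrite subr_eq0 eq_sym.
have nz2 : 1 - q ^+ 2 != 0.
  by rewrite -(expr1n _ 2) subr_sqr mulf_neq0 // addrC addr_eq0.
move: (H1 g) (H2 g) (H3 g) => /eqP + /eqP + /eqP.
rewrite !mulf_eq0 (negPf nz1) (negPf nz2) /= => a01 a23 a12 dt.
(* Both 1 - q and 1 - q^2 are nonzero, so a nonzero off-diagonal entry forces the other one and a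
   diagonal entry to vanish, contradicting invertibility. *)
apply/is_diag_mxP; apply: ord2P; apply: ord2P => // _; apply/eqP/negPn/negP => nz.
  move: a01 a12 dt; rewrite (negPf nz) orbF => /eqP -> /eqP ->.
  by rewrite mul0r mulr0 subrr eqxx.
move: a23 a12 dt; rewrite (negPf nz) orbF /= => /eqP -> /eqP ->.
by rewrite mul0r mulr0 subrr eqxx.
Qed.

End Diagonal.

Lemma diagonal_abelian : mx_faithful rho -> acts_diagonally rho -> abelian [set: gT]%g.
Proof.
move=> fai dg; apply/centsP => g _ h _; apply: (mx_faithful_inj fai); rewrite ?inE //.
have [/diag_mxP[x xE] /diag_mxP[y yE]] := (dg g, dg h).
by rewrite !rhoM xE yE diag_mxC.
Qed.

Lemma card_ord2 (P : pred 'I_2) : #|[set j | P j]| = (P 0%R + P 1%R)%N.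
Proof. by rewrite cardsE -sum1_card big_mkcond /= sum_ord2. Qed.

Lemma monomialP (A : 'M[K]_2) : A 0 0 * A 1 1 - A 0 1 * A 1 0 != 0 ->
  ((forall i, #|[set j | A i j != 0]| = 1%N) /\ (forall j, #|[set i | A i j != 0]| = 1%N))
  <-> A 0 0 * A 0 1 = 0 /\ A 1 0 * A 1 1 = 0.
Proof.
move=> dt; split=> [[r _]|[/eqP + /eqP]].
  move: (r 0) (r 1); rewrite !card_ord2.
  by do 4!case: eqP => [->|_]; rewrite /= ?mul0r ?mulr0.
move: dt; rewrite !mulf_eq0 => dt a01 a23; split; apply: ord2P; rewrite card_ord2;
  move: dt a01 a23; case: (eqVneq (A 0 0) 0) => [->|_]; case: (eqVneq (A 0 1) 0) => [->|_];
  case: (eqVneq (A 1 0) 0) => [->|_]; case: (eqVneq (A 1 1) 0) => [->|_] //=;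
  by rewrite ?(mul0r, mulr0) subrr eqxx.
Qed.

Lemma monomial_anticomm (q : K) c : q = -1 -> acts_monomially rho ->
  twisted (fun h => detQ q (rho h)) [set: gT] c -> pbw_condition rho q c.
Proof.
move=> -> mo tw; have m g := (monomialP (rho_det2 g)).1 (mo g).
by split=> // h; have [H1 H2] := m h; rewrite ?H1 ?H2 ?mulr0 // sqrrN expr1n subrr mul0r.
Qed.

Lemma pbw_monomial (q : K) c : q != 1 -> pbw_condition rho q c -> acts_monomially rho.
Proof.
move=> q1 [H1 H2 _ _] g; apply/(monomialP (rho_det2 g)).
have nz1 : 1 - q != 0 by rewrite subr_eq0 eq_sym.
by split; apply: (mulfI nz1); rewrite mulr0.
Qed.

(** At q = -1 the quantum determinant is the permanent, which is multiplicative on monomial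
    matrices. *)
Lemma detQ_monomialM g h : acts_monomially rho ->
  detQ (-1) (rho (g * h)%g) = detQ (-1) (rho g) * detQ (-1) (rho h).
Proof.
move=> mo; have [G1 G2] := (monomialP (rho_det2 g)).1 (mo g).
have [H1 H2] := (monomialP (rho_det2 h)).1 (mo h).
rewrite rhoM /detQ !mxE !sum_ord2; move: G1 G2 H1 H2.
move: (rho g) (rho h) => A B G1 G2 H1 H2; apply/eqP; rewrite -subr_eq0; apply/eqP.
(* The defect of multiplicativity for general A and B; each summand contains the product of a row of
   B, which is 0. *)
transitivity ((A 0 0 * A 1 0) * (B 0 0 * B 0 1) *+ 2 + (A 0 1 * A 1 1) * (B 1 0 * B 1 1) *+ 2).
  ring.
by rewrite H1 H2 !mulr0 !mul0rn addr0.
Qed.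

Lemma detQ_one q : detQ q (rho 1%g) = 1.
Proof. by rewrite repr_mx1 /detQ !mxE /= mulr0 mulr0 subr0 mulr1. Qed.

Lemma restrictT c : restrict [set: gT] c = c.
Proof. by apply/ffunP=> g; rewrite ffunE inE. Qed.

End Classification.

Theorem mainTheorem6 (K : fieldType) (gT : finGroupType)
    (rho : mx_representation K [set: gT]%G 2) (Hrho : mx_faithful rho)
    (q : K) (Hq : q != 0) :
  (* (1) *)
  (q = 1 ->
     let D := [set g : gT | \det (rho g) == 1] in
     let chi := fun h : gT => \det (rho h) in
     [/\ qdh_comprises rho q D (twisted chi D),
         arbitrary_on_reps chi D,
         (forall c, twisted chi D c -> forall g, g \in D ->
            c g = 0 \/ (forall h, h \in 'C[g]%g -> \det (rho h) = 1))
       & (forall c, twisted chi D c ->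
            c 1%g = 0 \/ (forall h, \det (rho h) = 1))]) /\
  (* (2) *)
  (q <> 1 -> q <> -1 ->
     [/\ (forall (Q : 'M[K]_2) kappa, Q 0 1 = q -> is_qdh rho Q kappa ->
            abelian [set: gT]%g /\ acts_diagonally rho),
         (acts_diagonally rho -> (forall g, detQ q (rho g) = 1) ->
            qdh_comprises rho q [set: gT] (fun _ => True))
       & ((exists g, detQ q (rho g) <> 1) ->
            forall (Q : 'M[K]_2) kappa, Q 0 1 = q -> is_qdh rho Q kappa ->
              (forall i j, kappa i j = 0) /\
              hecke_smash rho Q kappa q)]) /\
  (* (3) *)
  (q = -1 ->
     let chi := fun h : gT => detQ q (rho h) in
     [/\ ((-1 : K) <> 1 -> forall (Q : 'M[K]_2) kappa, Q 0 1 = q -> is_qdh rho Q kappa ->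
            acts_monomially rho),
         (acts_monomially rho ->
            qdh_comprises rho q [set: gT] (twisted chi [set: gT]) /\
            arbitrary_on_reps chi [set: gT])
       & (forall c, twisted chi [set: gT] c -> forall g,
            (exists2 h, h \in 'C[g]%g & detQ q (rho h) <> 1) -> c g = 0)]).
Proof.
split; [|split].
- move=> -> D chi.
  have cen c : twisted chi D c -> forall g, g \in D ->
      c g = 0 \/ (forall h, h \in 'C[g]%g -> \det (rho h) = 1).
    move=> tw g gD; have [->|/eqP cg] := eqVneq (c g) 0; first by left.
    by right=> h hC; case: (twisted_centralizer tw gD hC).
  split=> //.
  + exact: comprises_commutative.
  + apply: arbitrary_on_reps_character => [|g h|g h]; rewrite /chi.
    * by rewrite repr_mx1 det1.
    * by rewrite rhoM det_mulmx.
    * by rewrite !inE conjgE mulgA rhoJ_det.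
  + move=> c tw; have D1 : 1%g \in D by rewrite inE repr_mx1 det1.
    case: (cen c tw 1%g D1) => [|H]; [by left|right=> h].
    by apply: H; rewrite cent1C; apply/cent1P; rewrite /commute mulg1 mul1g.
- move=> /eqP q1 /eqP qN1; split.
  + move=> Q kappa qE qdh; subst q.
    have dg := pbw_diagonal q1 qN1 (qdh_condition qdh).
    by split; first exact: diagonal_abelian Hrho dg.
  + move=> dg det1; have ab := diagonal_abelian Hrho dg.
    apply: qdh_comprises_intro => // [c _|c _]; last by split=> // g; rewrite inE.
    have d0 g : rho g 0 1 = 0 /\ rho g 1 0 = 0.
      by have /is_diag_mxP E := dg g; split; apply: E.
    rewrite restrictT; split=> [h|h|h|g h _];
      try (by have [E1 E2] := d0 h; rewrite ?E1 ?E2 !(mul0r, mulr0)).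
    by rewrite /= det1 mul1r -mulgA (centsP ab g _ h) ?inE // mulKg.
  + move=> [g0 g0N1] Q kappa qE qdh; subst q.
    have Hc := qdh_condition qdh; have [_ _ _ tw] := Hc.
    have ab := diagonal_abelian Hrho (pbw_diagonal q1 qN1 Hc).
    have Hcoh := qdh_coherent qdh.
    (* G is abelian, so g0 lies in every centralizer. *)
    have c0 g : kappa 0 1 g = 0.
      have g0C : g0 \in 'C[g]%g by apply/cent1P/(centsP ab); rewrite inE.
      by case: (twisted_centralizer tw (in_setT g) g0C).
    split; last exact: hecke_smash_iso (qdh_nz qdh) Hcoh Hc c0.
    have [_ _ _ kii k10] := Hcoh.
    apply: ord2P; apply: ord2P; apply/ffunP => g; rewrite ffunE ?kii ?k10 ?c0 ?mulr0 //.
- move=> qE chi; split.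
  (* With -1 different from 1, the factor 1 - q is invertible and the products of entries in each
     row vanish. *)
  + move=> N1 Q kappa qE' qdh; apply: pbw_monomial (qdh_condition qdh).
    by rewrite qE' qE; apply/eqP.
  + move=> mo; split.
      apply: qdh_comprises_intro => // c; first by rewrite restrictT; apply: monomial_anticomm.
      by case=> _ _ _ tw; split=> // g; rewrite inE.
    apply: arbitrary_on_reps_character => [|g h|g h]; rewrite /chi ?inE //.
      exact: detQ_one.
    by rewrite qE detQ_monomialM.
  + move=> c tw g [h hC hN]; case: (twisted_centralizer tw (in_setT g) hC) => //.
Qed.
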